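(* Let $(\Delta,\mathbf{L})$ be a labelled compact convex simple polytope in $\mathbb{R}^m$ containing the origin, $f$ a positive affine linear function on $\Delta$, and $(\tilde\Delta,\tilde{\mathbf{L}})$ the $f$-twist of $(\Delta,\mathbf{L})$. Then $(\Delta,\mathbf{L})$ is $(f,m+2)$-$K$-stable if and only if $(\tilde\Delta,\tilde{\mathbf{L}})$ is $K$-stable.
   Context: **Labelled polytopes.** A labelled compact convex simple polytope $(\Delta,\mathbf{L})$ in $\mathbb{R}^m$ is a compact convex simple polytope $\Delta$ with non-empty interior and $d$ facets $F_1,\dots,F_d$, together with a set $\mathbf{L}=\{L_1,\dots,L_d\}$ of affine linear functions such that $\Delta=\{x\in\mathbb{R}^m: L_i(x)\ge 0,\ i=1,\dots,d\}$ and $F_i=\Delta\cap\{L_i=0\}$. No integrality of the $dL_i$ is assumed. **$f$-twist.** Assume $0\in\Delta$ and $f$ is affine linear and positive on $\Delta$. Put $T(x)=\tilde x=x/f(x)$. The $f$-twist of $(\Delta,\mathbf{L})$ is $(\tilde\Delta,\tilde{\mathbf{L}})$ with $\tilde\Delta=T(\Delta)$ and $\tilde{\mathbf{L}}=\{\tilde L_1,\dots,\tilde L_d\}$, $\tilde L_i(\tilde x)=L_i(x)/f(x)$; this is again a labelled polytope (the $\tilde L_i$ are affine linear in $\tilde x$) containing the origin. **Stability.** Let $dx$ be Lebesgue measure on $\mathbb{R}^m$ and let $d\sigma$ be the (positive) measure on $\partial\Delta$ defined on each facet $F_i$ by $dL_i\wedge d\sigma=-dx$. For $w\in\mathbb{R}$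 and $f$ affine linear and positive on $\Delta$, the $(f,w)$-Donaldson--Futaki invariant is $$\mathcal{F}_{\Delta,\mathbf{L},f,w}(\phi)=2\int_{\partial\Delta}\frac{\phi}{f^{w-1}}\,d\sigma-\int_\Delta\frac{\phi}{f^{w+1}}\,\zeta_{(\Delta,\mathbf{L},f,w)}\,dx,$$ where $\zeta_{(\Delta,\mathbf{L},f,w)}$ is the unique affine linear function such that $\mathcal{F}_{\Delta,\mathbf{L},f,w}(\phi)=0$ for all affine linear $\phi$. The labelled polytope $(\Delta,\mathbf{L})$ is *$(f,w)$-$K$-stable* if $\mathcal{F}_{\Delta,\mathbf{L},f,w}(\phi)\ge0$ for every convex piecewise affine linear function $\phi$ on $\Delta$ (a maximum of finitely many affine linear functions), with equality if and only if $\phi$ is affine linear. It is *$K$-stable* if this holds with $f\equiv1$ (in which case $w$ is irrelevant). *)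

(* Defs.v *)
From HB Require Import structures.
From mathcomp Require Import all_boot all_order all_algebra.
From mathcomp Require Import all_classical all_reals all_analysis.
From mathcomp Require Import measurable_realfun.

Set Implicit Arguments.
Unset Strict Implicit.
Unset Printing Implicit Defensive.

Import Order.TTheory GRing.Theory Num.Theory.
Import numFieldNormedType.Exports.

Local Open Scope classical_set_scope.
Local Open Scope ring_scope.

Definition rV_display : measure_display.
Proof. exact: default_measure_display. Qed.

(* 'rV[R]_n carries the sigma-algebra generated by the coordinates, which is
   the Borel one. *)
Section measurable_rV.
Variables (R : realType) (n : nat).

Let coord : 'I_n -> 'rV[R]_n -> R := fun i x => x ord0 i.

Let rV_set0 : g_sigma_preimage coord set0.
Proof. exact: sigma_algebra0. Qed.

Let rV_setC A : g_sigma_preimage coord A -> g_sigma_preimage coord (~` A).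
Proof. exact: sigma_algebraC. Qed.

Let rV_bigcup (F : _^nat) : (forall i, g_sigma_preimage coord (F i)) ->
  g_sigma_preimage coord (\bigcup_i (F i)).
Proof. exact: sigma_algebra_bigcup. Qed.

HB.instance Definition _ := @isMeasurable.Build rV_display
  'rV[R]_n (g_sigma_preimage coord) rV_set0 rV_setC rV_bigcup.

End measurable_rV.

Lemma measurable_coord (R : realType) n (i : 'I_n) :
  measurable_fun [set: 'rV[R]_n] (fun x => x ord0 i).
Proof.
move=> _ Y mY; rewrite setTI; apply: sub_sigma_algebra => /=.
rewrite -bigcup_seq/=; exists i => /=; first by rewrite mem_index_enum.
by exists Y => //; rewrite setTI.
Qed.

Lemma measurable_fun_coordP (R : realType) d (T : measurableType d) n
    (f : T -> 'rV[R]_n) :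
  measurable_fun [set: T] f <->
  forall i, measurable_fun [set: T] (fun t => f t ord0 i).
Proof.
split=> [mf i|mf].
  exact: (measurableT_comp (measurable_coord i) mf).
move=> _ A mA; rewrite setTI; move: A mA.
apply: smallest_sub.
  split=> [|A mA|F mF]; rewrite /= ?preimage_set0//.
    rewrite setTD preimage_setC; exact: measurableC.
  rewrite preimage_bigcup; exact: bigcupT_measurable.
move=> A; rewrite -bigcup_seq => -[i /= _ [B mB <-]].
by rewrite setTI; have := mf i measurableT _ mB; rewrite setTI.
Qed.

Definition rV_cons (R : realType) n (p : measurableTypeR R * 'rV[R]_n) :
    'rV[R]_n.+1 :=
  \row_i (if unlift ord0 i is Some j then p.2 ord0 j else p.1).

Fixpoint lebesgue_rV (R : realType) n : set 'rV[R]_n -> \bar R :=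
  match n with
  | 0 => dirac (0 : 'rV[R]_0)
  | n'.+1 => pushforward (lebesgue_measure \x @lebesgue_rV R n')%E
               (@rV_cons R n')
  end.
Arguments lebesgue_rV {R} n.

Definition rV_box (R : realType) n (a b : 'rV[R]_n) : set 'rV[R]_n :=
  [set x | forall i, x ord0 i \in `[a ord0 i, b ord0 i]].

Section lebesgue_rV_measure.
Variable R : realType.

Lemma measurable_rV_cons n : measurable_fun setT (@rV_cons R n).
Proof.
apply/measurable_fun_coordP => i; case: (unliftP ord0 i) => [j|] ->.
  rewrite (_ : (fun t => _) = (fun x : 'rV[R]_n => x ord0 j) \o snd).
    apply: measurableT_comp; [exact: measurable_coord|exact: measurable_snd].
  by apply/funext => t; rewrite mxE liftK.
rewrite (_ : (fun t => _) = fst); first exact: measurable_fst.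
by apply/funext => t; rewrite mxE unlift_none.
Qed.

Lemma measurable_rV_box n (a b : 'rV[R]_n) : measurable (rV_box a b).
Proof.
rewrite (_ : rV_box a b = \bigcap_(i in [set: 'I_n])
    ((fun x : 'rV[R]_n => x ord0 i) @^-1` `[a ord0 i, b ord0 i]%classic)).
  apply: fin_bigcap_measurable => // i _; rewrite -[X in measurable X]setTI.
  exact: measurable_coord.
by apply/seteqP; split=> x /= xab i => [_|]; apply: xab.
Qed.

Lemma rV_cons_box n (a b : 'rV[R]_n.+1) :
  @rV_cons R n @^-1` rV_box a b =
  `[a ord0 ord0, b ord0 ord0]%classic `*` rV_box (col' ord0 a) (col' ord0 b).
Proof.
apply/seteqP; split=> -[t x] /=.
  move=> xab; split=> /= [|i].
    by have := xab ord0; rewrite mxE unlift_none.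
  by rewrite !mxE; have := xab (lift ord0 i); rewrite mxE liftK.
move=> [/= tab xab] i; rewrite mxE; case: unliftP => [j|] ->//.
by have := xab j; rewrite !mxE.
Qed.

Let bigbox n k : set 'rV[R]_n := rV_box (const_mx (- k%:R)) (const_mx k%:R).

Let bigbox_cover n : \bigcup_k @bigbox n k = setT.
Proof.
apply/seteqP; split=> // x _.
exists (\max_(i < n) (Num.truncn `|x ord0 i|).+1)%N => // i.
rewrite in_itv /= !mxE -ler_norml.
apply: (@le_trans _ _ (Num.truncn `|x ord0 i|).+1%:R).
  exact/ltW/truncnS_gt.
by rewrite ler_nat (@leq_bigmax _ (fun i => (Num.truncn `|x ord0 i|).+1)).
Qed.

Let lebesgue_rV_structure n :
  {mu : {sigma_finite_measure set 'rV[R]_n -> \bar R} |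
    mu = @lebesgue_rV R n :> (set 'rV[R]_n -> \bar R)
    & forall a b, (mu (rV_box a b) < +oo)%E}.
Proof.
elim: n => [|n [mu muE muoo]].
  by exists (dirac (0 : 'rV[R]_0)) => // a b; rewrite /= /dirac ltry.
pose nu : {measure set 'rV[R]_n.+1 -> \bar R} :=
  measure_function_pushforward__canonical__measure_function_Measure
    (lebesgue_measure \x mu)%E (@measurable_rV_cons n).
have nuoo a b : (nu (rV_box a b) < +oo)%E.
  rewrite /nu /= /pushforward rV_cons_box product_measure1E//; last first.
    exact: measurable_rV_box.
  rewrite lte_mul_pinfty ?measure_ge0//.
  rewrite ge0_fin_numE//= lebesgue_measure_itv/=; case: ifP => // _.
  by rewrite -EFinB ltry.
have sfnu : sigma_finite setT nu.
  exists (@bigbox n.+1); first by rewrite bigbox_cover.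
  by move=> k; split; [exact: measurable_rV_box|exact: nuoo].
pose snu := Measure_isSigmaFinite.Build _ _ _ nu sfnu.
pose nu' : {sigma_finite_measure set 'rV[R]_n.+1 -> \bar R} :=
  HB.pack (nu : set 'rV[R]_n.+1 -> \bar R) nu snu.
by exists nu' => //=; rewrite -muE.
Qed.

Let lebesgue_rV0 n : @lebesgue_rV R n set0 = 0%E.
Proof. by case: (lebesgue_rV_structure n) => mu <- _; rewrite measure0. Qed.

Let lebesgue_rV_ge0 n (A : set 'rV[R]_n) : (0 <= lebesgue_rV n A)%E.
Proof. by case: (lebesgue_rV_structure n) => mu <- _; rewrite measure_ge0. Qed.

Let lebesgue_rV_sigma_additive n : semi_sigma_additive (@lebesgue_rV R n).
Proof.
case: (lebesgue_rV_structure n) => mu <- _.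
exact: measure_semi_sigma_additive.
Qed.

HB.instance Definition _ n := isMeasure.Build _ _ _ (@lebesgue_rV R n)
  (lebesgue_rV0 n) (@lebesgue_rV_ge0 n) (@lebesgue_rV_sigma_additive n).

Let lebesgue_rV_sigma_finite n : sigma_finite setT (@lebesgue_rV R n).
Proof. by case: (lebesgue_rV_structure n) => mu <- _; exact: sigma_finiteT. Qed.

HB.instance Definition _ n := Measure_isSigmaFinite.Build _ _ _
  (@lebesgue_rV R n) (lebesgue_rV_sigma_finite n).

Lemma lebesgue_rV_box n (a b : 'rV[R]_n) :
  (forall i, a ord0 i <= b ord0 i) ->
  lebesgue_rV n (rV_box a b) = (\prod_(i < n) (b ord0 i - a ord0 i))%:E.
Proof.
elim: n a b => [|n IH] a b ab.
  by rewrite /= big_ord0 diracE mem_set// => -[].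
rewrite [LHS](_ : _ = (lebesgue_measure \x @lebesgue_rV R n)%E
  (@rV_cons R n @^-1` rV_box a b))// rV_cons_box.
rewrite product_measure1E//=; last exact: measurable_rV_box.
rewrite IH; last by move=> i; rewrite !mxE.
rewrite lebesgue_measure_itv/= lte_fin big_ord_recl/= EFinM.
congr (_ * _)%E; last by congr EFin; apply: eq_bigr => i _; rewrite !mxE.
have := ab ord0; rewrite le_eqVlt => /predU1P[->|->]; last by rewrite EFinB.
by rewrite ltxx subrr.
Qed.

End lebesgue_rV_measure.

Record affine (R : realType) (m : nat) :=
  Affine { aff_lin : 'rV[R]_m ; aff_cst : R }.

HB.instance Definition _ R m := gen_eqMixin (affine R m).
HB.instance Definition _ R m := gen_choiceMixin (affine R m).

Definition affine_fun (R : realType) m (l : affine R m) (x : 'rV[R]_m) : R :=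
  \sum_(j < m) aff_lin l ord0 j * x ord0 j + aff_cst l.
Coercion affine_fun : affine >-> Funclass.

Definition affine1 (R : realType) m : affine R m := Affine 0 1.
Arguments affine1 {R m}.

Section polytopes.
Variables (R : realType) (m : nat).
Implicit Types (D F : set 'rV[R]_m) (f l : affine R m).

Definition zero_face D l : set 'rV[R]_m := D `&` [set x | l x = 0].

Definition is_face D F :=
  exists l, (forall x, D x -> 0 <= l x) /\ F = zero_face D l.

(* The affine hull of F is p + <rows of A>, of dimension k. *)
Definition has_affine_dim F k :=
  exists (p : 'rV[R]_m) (A : 'M[R]_(k, m)),
    [/\ F p, forall i, F (p + row i A), row_free A
      & forall x, F x -> (x - p <= A)%MS].

Definition is_facet D F :=
  is_face D F /\ exists2 k, m = k.+1 & has_affine_dim F k.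

Definition is_vertex D v := is_face D [set v].

(* Convexity of D follows from lp_halfspaces. *)
Record labelled_polytope (D : set 'rV[R]_m) d (L : 'I_d -> affine R m) : Prop :=
  LabelledPolytope {
    lp_compact : compact D ;
    lp_interior : interior D !=set0 ;
    lp_halfspaces : D = [set x | forall i, 0 <= L i x] ;
    lp_facets : forall F, is_facet D F <-> exists i, F = zero_face D (L i) ;
    lp_facets_distinct : injective (fun i => zero_face D (L i)) ;
    lp_simple : forall v, is_vertex D v -> #|[pred i | L i v == 0]| = m }.

Definition twist_pt (f : affine R m) (x : 'rV[R]_m) : 'rV[R]_m :=
  (f x)^-1 *: x.

(* The affine function of x / f x equal to l x / f x; note that
   aff_cst f = f 0. See [twist_affE]. *)
Definition twist_aff (f l : affine R m) : affine R m :=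
  let c := aff_cst l / aff_cst f in
  Affine (aff_lin l - c *: aff_lin f) c.

Lemma affine0E l : l 0 = aff_cst l.
Proof. by rewrite /affine_fun big1 ?add0r// => j _; rewrite mxE mulr0. Qed.

Lemma twist_affE f l x : f 0 != 0 -> f x != 0 ->
  twist_aff f l (twist_pt f x) = l x / f x.
Proof.
rewrite affine0E => f0 fx0; apply: (mulIf fx0); rewrite divfK//.
set c := aff_cst l / aff_cst f.
have cE : aff_cst l = c * aff_cst f by rewrite divfK.
rewrite {1}/affine_fun /= -/c mulrDl mulr_suml.
rewrite (eq_bigr (fun j => aff_lin l ord0 j * x ord0 j -
    c * (aff_lin f ord0 j * x ord0 j))); last first.
  by move=> j _; rewrite !mxE -mulrA [_ * f x]mulrC mulVKf// mulrBl mulrA.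
by rewrite sumrB -mulr_sumr /affine_fun mulrDr -cE addrA subrK.
Qed.

Definition twist_set f D := twist_pt f @` D.

Definition twist_labels f d (L : 'I_d -> affine R m) : 'I_d -> affine R m :=
  fun i => twist_aff f (L i).

End polytopes.

Section facet_measure.
Variables (R : realType) (m : nat) (l : affine R m).

(* The hyperplane l = 0 as a graph over the coordinates other than k. *)
Definition hyperplane_chart (k : 'I_m) (y : 'rV[R]_m.-1) : 'rV[R]_m :=
  \row_j (if unlift k j is Some j' then y ord0 j' else
    - (\sum_(i < m.-1) aff_lin l ord0 (lift k i) * y ord0 i + aff_cst l)
      / aff_lin l ord0 k).

Lemma hyperplane_chartP k y : aff_lin l ord0 k != 0 ->
  l (hyperplane_chart k y) = 0.
Proof.
move=> lk0; rewrite /affine_fun (bigD1_ord k)//= mxE unlift_none mulrC divfK//.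
under [X in _ + X + _]eq_bigr do rewrite mxE liftK.
by rewrite -addrA addNr.
Qed.

(* Write a_k for the k-th partial derivative of l. If a_k != 0, then on l = 0 the
   equation dl /\ dsigma = -dx forces dsigma to be, up to sign, the product of
   the dx_j with j != k divided by a_k. Hence the positive measure sigma is
   |a_k|^-1 times Lebesgue measure in the coordinates other than k; the result
   does not depend on the k picked. *)
Definition facet_measure (A : set 'rV[R]_m) : \bar R :=
  if [pick k | aff_lin l ord0 k != 0] is Some k
  then (`|aff_lin l ord0 k|^-1%:E
        * lebesgue_rV m.-1 (hyperplane_chart k @^-1` A))%E
  else 0%E.

Lemma measurable_hyperplane_chart k : measurable_fun setT (hyperplane_chart k).
Proof.
apply/measurable_fun_coordP => j; case: (unliftP k j) => [i|] ->.
  under eq_fun do rewrite mxE liftK.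
  exact: measurable_coord.
under eq_fun do rewrite mxE unlift_none.
apply: measurable_funM => //; apply: measurableT_comp => //.
apply: measurable_funD => //; apply: measurable_sum => i.
by apply: measurable_funM => //; exact: measurable_coord.
Qed.

Let facet_measure0 : facet_measure set0 = 0%E.
Proof.
rewrite /facet_measure; case: pickP => // k _.
by rewrite preimage_set0 measure0 mule0.
Qed.

Let facet_measure_ge0 A : (0 <= facet_measure A)%E.
Proof.
rewrite /facet_measure; case: pickP => // k _.
by rewrite mule_ge0// lee_fin.
Qed.

Let facet_measure_sigma_additive : semi_sigma_additive facet_measure.
Proof.
rewrite /facet_measure; case: pickP => [k _|_]; last first.
  exact: (@measure_semi_sigma_additive _ _ _ mzero).
have r0 : 0 <= `|aff_lin l ord0 k|^-1 by rewrite invr_ge0.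
pose r : {nonneg R} := NngNum r0.
pose mu : {measure set 'rV[R]_m -> \bar R} :=
  measure_function_pushforward__canonical__measure_function_Measure
    (lebesgue_rV m.-1) (@measurable_hyperplane_chart k).
rewrite (_ : (fun A => _) = mscale r mu); last by apply/funext.
exact: measure_semi_sigma_additive.
Qed.

HB.instance Definition _ := isMeasure.Build _ _ _ facet_measure
  facet_measure0 facet_measure_ge0 facet_measure_sigma_additive.

End facet_measure.

Section stability.
Variables (R : realType) (m : nat).
Variables (D : set 'rV[R]_m) (d : nat) (L : 'I_d -> affine R m).

Definition boundary_integral (g : 'rV[R]_m -> R) : R :=
  \sum_(i < d) \int[facet_measure (L i)]_(x in zero_face D (L i)) g x.

Definition DF_wrt (zeta f : affine R m) (w : R) (phi : 'rV[R]_m -> R) : R :=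
  2 * boundary_integral (fun x => phi x / f x `^ (w - 1))
  - \int[lebesgue_rV m]_(x in D) (phi x / f x `^ (w + 1) * zeta x).

(* The zeta for which DF_wrt vanishes on all affine functions; it exists and is
   unique when D is a labelled polytope and f > 0 on D. *)
Definition extremal_affine (f : affine R m) (w : R) : affine R m :=
  xget (Affine 0 0)
    [set zeta | forall l : affine R m, DF_wrt zeta f w l = 0].

Definition donaldson_futaki (f : affine R m) (w : R) (phi : 'rV[R]_m -> R) :=
  DF_wrt (extremal_affine f w) f w phi.

Definition convex_pl (phi : 'rV[R]_m -> R) :=
  exists (l : affine R m) (s : seq (affine R m)),
    forall x, D x -> phi x = \big[Num.max/l x]_(l' <- s) l' x.

Definition affine_on (phi : 'rV[R]_m -> R) :=
  exists l : affine R m, forall x, D x -> phi x = l x.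

Definition fw_K_stable (f : affine R m) (w : R) :=
  forall phi, convex_pl phi ->
    0 <= donaldson_futaki f w phi
    /\ (donaldson_futaki f w phi = 0 <-> affine_on phi).

(* For f = 1 the value of w is irrelevant; see [K_stableE]. *)
Definition K_stable := fw_K_stable affine1 0.

Lemma affine1E x : @affine1 R m x = 1.
Proof.
by rewrite /affine_fun big1 ?add0r// => j _; rewrite mxE mul0r.
Qed.

Lemma K_stableE w : fw_K_stable affine1 w = K_stable.
Proof.
rewrite /K_stable /fw_K_stable /donaldson_futaki.
suff DFE zeta : DF_wrt zeta affine1 w = DF_wrt zeta affine1 0.
  by rewrite /extremal_affine; under eq_set do rewrite DFE; rewrite DFE.
apply/funext => phi; rewrite /DF_wrt /boundary_integral.
congr (_ * _ - _).
  by apply: eq_bigr => i _; apply: eq_Rintegral => x _; rewrite affine1E !powR1.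
by apply: eq_Rintegral => x _; rewrite affine1E !powR1.
Qed.

End stability.

(* Main.v *)
Require Import Defs.
From HB Require Import structures.
From mathcomp Require Import all_boot all_order all_algebra.
From mathcomp Require Import all_classical all_reals all_analysis.
From mathcomp Require Import measurable_realfun.
From mathcomp Require Import ring lra.

Import Order.TTheory GRing.Theory Num.Theory.
Import numFieldNormedType.Exports.

Local Open Scope classical_set_scope.
Local Open Scope ring_scope.

(** The twist T x = x / f x is the restriction to affine charts of the linear
    map (s, z) |-> (s f(z / s), z) between the cones over Delta and over its
    twist. Integrating over cones against a weight in the height variable turns
    Lebesgue measure on R^m into f^-(m+1) dx, so T carries f(0) f^-(m+1) dx to
    dx and, by the same argument on the cones over the facets,
    f(0) f^-m dsigma to dsigma. For psi (T x) = phi x / f x, with zeta twisted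
    likewise, the Donaldson-Futaki functionals of weight m + 2 therefore differ
    by the factor f(0) > 0. Multiplication by f matches convex piecewise affine
    and affine functions on both sides, and since the extremal affine function
    is unique the twist of one is the other. *)

(** * Affine substitution on the real line *)

Section real_change_of_variables.
Context {R : realType}.
Local Notation mR := (measurableTypeR R).

Lemma measurable_inv : measurable_fun [set: R] (fun x : R => x^-1).
Proof.
have m0 : measurable [set 0 : R] by exact: measurable_set1.
rewrite -(setvU [set 0 : R]); apply/measurable_funU => //.
  exact: measurableC.
split; last exact: measurable_fun_set1.
apply: open_continuous_measurable_fun.
  by apply: closed_openC; exact: closed_eq.
by move=> x /set_mem /eqP x0; exact: inv_continuous.
Qed.

(** By uniqueness of Lebesgue measure: the pushforward under [x |-> a * x + b], scaled by [|a|],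
    gives each half-open interval its length. *)
Lemma integral_affine_subst (a b : R) (g : R -> \bar R) : a != 0 ->
  measurable_fun [set: mR] g -> (forall x, 0 <= g x)%E ->
  (\int[lebesgue_measure]_x g x =
   `|a|%:E * \int[lebesgue_measure]_x g (a * x + b)%R)%E.
Proof.
move=> a0 mg g0.
have mphi : measurable_fun [set: mR] ((fun x => a * x + b) : mR -> mR).
  apply: measurable_funD => //; exact: measurable_funM.
pose mu : {measure set mR -> \bar R} :=
  measure_function_pushforward__canonical__measure_function_Measure
    lebesgue_measure mphi.
pose r : {nonneg R} := NngNum (normr_ge0 a).
rewrite (@eq_measure_integral _ _ _ _ (mscale r mu)); last first.
  move=> A mA _; apply: lebesgue_measure_unique => // X [[x y] _ <-].
  rewrite /= /mscale /= /pushforward /=.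
  have [xy|yx] := ltP x y; last first.
    have -> : `]x, y]%classic = set0 :> set R.
      by apply/seteqP; split => z //=; rewrite in_itv /=; lra.
    by rewrite preimage_set0 !measure0 mule0.
  have [ap|an] := ltP 0 a.
    have -> : (fun z => a * z + b) @^-1` `]x, y] =
        `](x - b) / a, (y - b) / a]%classic.
      apply/seteqP; split => z /=; rewrite !in_itv /= ltr_pdivrMr// ler_pdivlMr//; lra.
    rewrite !lebesgue_measure_itv/= !lte_fin xy ltr_pM2r ?invr_gt0// ltrD2r xy.
    by rewrite -!EFinB -EFinM gtr0_norm//; congr EFin; field.
  have {}an : a < 0 by rewrite lt_neqAle a0.
  (* A negative slope swaps the endpoints, so the preimage is closed on the left and open on the
     right; its length is the same. *)
  have -> : (fun z => a * z + b) @^-1` `]x, y] =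
      `[(y - b) / a, (x - b) / a[%classic.
    apply/seteqP; split => z /=; rewrite !in_itv /= ltr_ndivlMr// ler_ndivrMr//; lra.
  rewrite !lebesgue_measure_itv/= !lte_fin xy ltr_nM2r ?invr_lt0// ltrD2r xy.
  by rewrite -!EFinB -EFinM ltr0_norm//; congr EFin; field.
rewrite ge0_integral_mscale//; congr (_ * _)%E.
by rewrite ge0_integral_pushforward//.
Qed.

End real_change_of_variables.

(** * Iterated integrals and dilations in R^n *)

Section integration_rV.
Context {R : realType}.
Local Notation mR := (measurableTypeR R).
Local Notation lebR := (@lebesgue_measure R).

(** The variant of [rV_cons] with the new coordinate at an arbitrary place: the chart of a
    hyperplane singles out a coordinate that need not be the first. *)
Definition rV_insert {n} (k : 'I_n.+1) (p : mR * 'rV[R]_n) : 'rV[R]_n.+1 :=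
  \row_j (if unlift k j is Some i then p.2 ord0 i else p.1).

Lemma rV_insert_lift {n} (k : 'I_n.+1) p i :
  rV_insert k p ord0 (lift k i) = p.2 ord0 i.
Proof. by rewrite mxE liftK. Qed.

Lemma rV_insert_id {n} (k : 'I_n.+1) p : rV_insert k p ord0 k = p.1.
Proof. by rewrite mxE unlift_none. Qed.

Lemma measurable_rV_insert {n} (k : 'I_n.+1) :
  measurable_fun [set: mR * 'rV[R]_n] (rV_insert k).
Proof.
apply/measurable_fun_coordP => i; case: (unliftP k i) => [j|] ->.
  under eq_fun do rewrite rV_insert_lift.
  exact: (measurableT_comp (measurable_coord j) measurable_snd).
under eq_fun do rewrite rV_insert_id.
exact: measurable_fst.
Qed.

Lemma rV_insertC {n} (k : 'I_n.+1) t0 t (y : 'rV[R]_n) :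
  rV_insert ord0 (t0, rV_insert k (t, y)) =
  rV_insert (lift ord0 k) (t, rV_insert ord0 (t0, y)).
Proof.
apply/rowP => i; case: (unliftP ord0 i) => [j|] ->; last first.
  rewrite rV_insert_id/= (_ : ord0 = lift (lift ord0 k) ord0); last exact/val_inj.
  by rewrite rV_insert_lift/= rV_insert_id.
rewrite rV_insert_lift/=; case: (unliftP k j) => [j'|] ->; last first.
  by rewrite !rV_insert_id.
rewrite rV_insert_lift/=.
rewrite (_ : lift ord0 (lift k j') = lift (lift ord0 k) (lift ord0 j')); last first.
  by apply/val_inj; rewrite /= /bump !leq0n !add1n ltnS addnS.
by rewrite !rV_insert_lift/=.
Qed.

Lemma measurable_integral_snd {d1 d2} {T1 : measurableType d1}
    {T2 : measurableType d2} (mu : {sigma_finite_measure set T2 -> \bar R})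
    (g : T1 * T2 -> \bar R) :
  measurable_fun setT g -> (forall x, 0 <= g x)%E ->
  measurable_fun setT (fun x => \int[mu]_y g (x, y))%E.
Proof. by move=> mg g0; exact: measurable_fun_fubini_tonelli_F. Qed.

Lemma integral_rVS n (g : 'rV[R]_n.+1 -> \bar R) :
  measurable_fun setT g -> (forall x, 0 <= g x)%E ->
  (\int[lebesgue_rV n.+1]_x g x =
   \int[lebR]_t \int[lebesgue_rV n]_y g (rV_insert ord0 (t, y)))%E.
Proof.
move=> mg g0.
have mi := @measurable_rV_cons R n.
rewrite (@eq_measure_integral _ _ _ _
  (measure_function_pushforward__canonical__measure_function_Measure
    (lebesgue_measure \x lebesgue_rV n)%E mi)); last by [].
rewrite ge0_integral_pushforward// fubini_tonelli1//=; last first.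
  exact: measurableT_comp.
Qed.

Local Opaque lebesgue_rV.

(** Induction on the dimension: split off coordinate 0, pull out the wanted coordinate inside the
    slice, then exchange the two real integrals by Tonelli; [rV_insertC] identifies the resulting
    points. *)
Lemma integral_rV_insert n (k : 'I_n.+1) (g : 'rV[R]_n.+1 -> \bar R) :
  measurable_fun setT g -> (forall x, 0 <= g x)%E ->
  (\int[lebesgue_rV n.+1]_x g x =
   \int[lebR]_t \int[lebesgue_rV n]_y g (rV_insert k (t, y)))%E.
Proof.
elim: n k g => [|n IH] k g mg g0; first by rewrite (ord1 k) integral_rVS.
case: (unliftP ord0 k) => [k'|] ->; last by rewrite integral_rVS.
rewrite (integral_rVS _ _ mg g0).
have m1 t : measurable_fun setT (fun y : 'rV[R]_n.+1 => g (rV_insert ord0 (t, y))).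
  apply: measurableT_comp => //; apply: measurableT_comp.
    exact: measurable_rV_insert.
  exact: pair1_measurable.
under eq_integral => t _ do rewrite (IH k')//.
pose G (p : mR * mR) := (\int[lebesgue_rV n]_y
  g (rV_insert ord0 (p.1, rV_insert k' (p.2, y))))%E.
have mG : measurable_fun setT G.
  apply: (@measurable_integral_snd _ _ (mR * mR)%type _ (lebesgue_rV n) (fun q =>
    g (rV_insert ord0 (q.1.1, rV_insert k' (q.1.2, q.2))))) => //.
  apply: measurableT_comp => //; apply: measurableT_comp.
    exact: measurable_rV_insert.
  apply: measurable_fun_pair.
    exact: (measurableT_comp measurable_fst measurable_fst).
  apply: measurableT_comp; first exact: measurable_rV_insert.
  apply: measurable_fun_pair; last exact: measurable_snd.
  exact: (measurableT_comp measurable_snd measurable_fst).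
have G0 p : (0 <= G p)%E by exact: integral_ge0.
transitivity (\int[lebR]_t \int[lebR]_t0 G (t0, t))%E.
  exact: (fubini_tonelli G mG G0).
apply: eq_integral => t _; rewrite [RHS]integral_rVS; last 2 first.
- apply: measurableT_comp => //; apply: measurableT_comp.
    exact: measurable_rV_insert.
  exact: pair1_measurable.
- by [].
apply: eq_integral => t0 _; apply: eq_integral => y _.
by rewrite rV_insertC.
Qed.

Lemma measurable_scaleV d (T : measurableType d) n (s : T -> R) (z : T -> 'rV[R]_n) :
  measurable_fun setT s -> measurable_fun setT z ->
  measurable_fun setT (fun t => (s t)^-1 *: z t).
Proof.
move=> ms mz; apply/measurable_fun_coordP => i.
under eq_fun do rewrite mxE.
apply: measurable_funM; first by apply: measurableT_comp => //; exact: measurable_inv.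
by move/measurable_fun_coordP : mz; exact.
Qed.

Lemma measurable_scale d (T : measurableType d) n (s : T -> R) (z : T -> 'rV[R]_n) :
  measurable_fun setT s -> measurable_fun setT z ->
  measurable_fun setT (fun t => s t *: z t).
Proof.
move=> ms mz; apply/measurable_fun_coordP => i.
under eq_fun do rewrite mxE.
by apply: measurable_funM => //; move/measurable_fun_coordP : mz; exact.
Qed.

(** Induction on the dimension, each coordinate giving one factor [s] by the substitution on the
    line. *)
Lemma integral_rV_scale n (s : R) (g : 'rV[R]_n -> \bar R) : 0 < s ->
  measurable_fun setT g -> (forall x, 0 <= g x)%E ->
  (\int[lebesgue_rV n]_z g z =
   (s ^+ n)%:E * \int[lebesgue_rV n]_x g (s *: x)%R)%E.
Proof.
move=> s0; elim: n g => [|n IH] g mg g0.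
  rewrite expr0 mul1e; apply: eq_integral => x _; congr g.
  by apply/rowP => -[].
have mgs : measurable_fun setT (fun x : 'rV[R]_n.+1 => g (s *: x)).
  by apply: measurableT_comp => //; exact: measurable_scale.
rewrite (integral_rVS _ _ mg g0) (integral_rVS _ _ mgs)//.
have m1 : measurable_fun setT (fun p : mR * 'rV[R]_n => g (rV_insert ord0 (s * p.1, s *: p.2))).
  apply: measurableT_comp => //; apply: measurableT_comp; first exact: measurable_rV_insert.
  apply: measurable_fun_pair; first by apply: measurable_funM => //; exact: measurable_fst.
  by apply: measurable_scale => //; exact: measurable_snd.
have m2 : measurable_fun setT (fun p : mR * 'rV[R]_n => g (rV_insert ord0 p)).
  by apply: measurableT_comp => //; exact: measurable_rV_insert.
pose G t := (\int[lebesgue_rV n]_y g (rV_insert ord0 (t, y)))%E.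
pose H t := (\int[lebesgue_rV n]_y g (rV_insert ord0 (s * t, s *: y)%R))%E.
have mG : measurable_fun [set: mR] G.
  exact: (@measurable_integral_snd _ _ mR _ (lebesgue_rV n) _ m2).
have mH : measurable_fun [set: mR] H.
  exact: (@measurable_integral_snd _ _ mR _ (lebesgue_rV n) _ m1).
have G0 t : (0 <= G t)%E by exact: integral_ge0.
have H0 t : (0 <= H t)%E by exact: integral_ge0.
have sn0 : (0 <= (s ^+ n)%:E)%E by rewrite lee_fin exprn_ge0// ltW.
transitivity (s%:E * \int[lebR]_t G (s * t)%R)%E.
  have s_neq0 : s != 0 by rewrite gt_eqF.
  rewrite [LHS](integral_affine_subst s 0 G s_neq0 mG G0) (gtr0_norm s0).
  by congr (_ * _)%E; apply: eq_integral => t _; rewrite addr0.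
transitivity ((s ^+ n.+1)%:E * \int[lebR]_t H t)%E; last first.
  congr (_ * _)%E; apply: eq_integral => t _; apply: eq_integral => y _; congr g.
  by apply/rowP => i; rewrite !mxE; case: unliftP => [j _|_] /=; rewrite ?mxE.
rewrite exprS EFinM -muleA; congr (_ * _)%E.
rewrite -(ge0_integralZl lebR measurableT mH (fun t _ => H0 t) sn0).
apply: eq_integral => t _; rewrite /G IH//.
apply: (measurableT_comp m2); exact: pair1_measurable.
Qed.

End integration_rV.

(** * Weighted integrals over cones *)

Section cone_integral.
Context {R : realType}.
Local Notation mR := (measurableTypeR R).
Local Notation lebR := (@lebesgue_measure R).
Local Opaque lebesgue_rV.

(** Chosen so that [u ^+ n] times the weight is the indicator of []0, 1]], of integral 1: the factor
    [u ^- n] cancels the Jacobian of a slice, and the cut-off truncates the cone. *)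
Definition cone_weight n (u : R) : \bar R :=
  if (0 < u) && (u <= 1) then (u ^- n)%:E else 0%E.

Lemma cone_weight_ge0 n u : (0 <= cone_weight n u)%E.
Proof.
rewrite /cone_weight; case: ifP => // /andP[u0 _].
by rewrite lee_fin invr_ge0 exprn_ge0// ltW.
Qed.

Lemma cone_weight_le0 n u : u <= 0 -> cone_weight n u = 0%E.
Proof. by move=> u0; rewrite /cone_weight ltNge u0. Qed.

Lemma measurable_cone_weight n : measurable_fun [set: mR] (cone_weight n).
Proof.
apply: measurable_fun_ifT => //.
  by apply: measurable_and; [exact: measurable_fun_ltr|exact: measurable_fun_ler].
apply/measurable_EFinP; apply: measurableT_comp; first exact: measurable_inv.
exact: measurable_funX.
Qed.

(** Substitute [u = a * s]: the integrand becomes [a ^- n] times the indicator of []0, 1]], and [ds]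
    supplies the last factor [a^-1]. *)
Lemma integral_cone_weight n (a : R) : 0 < a ->
  (\int[lebR]_s ((`|s| ^+ n)%:E * cone_weight n (s * a)%R) = (a ^- n.+1)%:E)%E.
Proof.
move=> a0.
pose G (u : R) := ((`|u| ^+ n)%:E * cone_weight n u)%E.
have mG : measurable_fun [set: mR] G.
  apply: emeasurable_funM; last exact: measurable_cone_weight.
  by apply/measurable_EFinP; apply: measurable_funX; exact: normr_measurable.
have G0 u : (0 <= G u)%E by rewrite mule_ge0 ?cone_weight_ge0// lee_fin exprn_ge0.
have intG : (\int[lebR]_u G u = 1)%E.
  transitivity (\int[lebR]_u (\1_(`]0, 1]%classic : set R) u)%:E)%E.
    apply: eq_integral => u _; rewrite indicE /G /cone_weight.
    rewrite mem_setE in_itv /=; case: ifP => [/andP[u0 _]|_]; last by rewrite mule0.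
    by rewrite gtr0_norm// -EFinM divff// expf_neq0// gt_eqF.
  rewrite integral_indic// setIT /= lebesgue_measure_itv/= lte_fin ltr01.
  by rewrite oppr0 adde0.
pose H s := ((`|s| ^+ n)%:E * cone_weight n (s * a)%R)%E.
have mH : measurable_fun [set: mR] H.
  apply: emeasurable_funM.
    by apply/measurable_EFinP; apply: measurable_funX; exact: normr_measurable.
  apply: measurableT_comp; first exact: measurable_cone_weight.
  exact: measurable_funM.
have H0 u : (0 <= H u)%E by rewrite mule_ge0 ?cone_weight_ge0// lee_fin exprn_ge0.
have an0 : a != 0 by rewrite gt_eqF.
have GH : (\int[lebR]_s G (a * s + 0)%R = (a ^+ n)%:E * \int[lebR]_s H s)%E.
  rewrite -(ge0_integralZl lebR measurableT mH (fun t _ => H0 t)); last first.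
    by rewrite lee_fin exprn_ge0// ltW.
  apply: eq_integral => s _; rewrite /G /H addr0 mulrC normrM (gtr0_norm a0).
  by rewrite exprMn EFinM -muleA muleCA.
have := integral_affine_subst a 0 G an0 mG G0.
rewrite intG GH gtr0_norm// muleA -EFinM -exprS => E.
transitivity ((a ^- n.+1)%:E * ((a ^+ n.+1)%:E * \int[lebR]_s H s))%E.
  by rewrite muleA -EFinM mulVf ?mul1e// expf_neq0.
by rewrite -E mule1.
Qed.

Section cone.
Variables (n : nat) (f : 'rV[R]_n -> R) (h : 'rV[R]_n -> \bar R).
Hypotheses (mf : measurable_fun setT f) (mh : measurable_fun setT h).
Hypotheses (h0 : forall x, (0 <= h x)%E) (hf : forall x, h x != 0%E -> 0 < f x).

(** For [p = (s, z)], the point [s^-1 *: z] is where the ray through [p] meets the base [s = 1], and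
    [s * f (s^-1 *: z)] is the extension of [f] from the base that is homogeneous of degree one. *)
Let Phi w (p : mR * 'rV[R]_n) : \bar R :=
  (cone_weight w (p.1 * f (p.1^-1 *: p.2))%R * h (p.1^-1 *: p.2)%R)%E.

Lemma measurable_cone w : measurable_fun setT (Phi w).
Proof.
have m1 : measurable_fun setT (fun p : mR * 'rV[R]_n => p.1^-1 *: p.2).
  by apply: measurable_scaleV; [exact: measurable_fst|exact: measurable_snd].
apply: emeasurable_funM; last exact: measurableT_comp.
apply: measurableT_comp; first exact: measurable_cone_weight.
apply: measurable_funM; first exact: measurable_fst.
exact: measurableT_comp.
Qed.

Lemma cone_ge0 w p : (0 <= Phi w p)%E.
Proof. by rewrite mule_ge0// cone_weight_ge0. Qed.

(* Both sides compute the integral of [Phi] over the cone on the support of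
   [h]: rescaling each slice [s = const] separates the variables, and the
   factor [f^-(n+1)] is what the height variable contributes. *)
Lemma integral_cone :
  (\int[lebesgue_rV n]_x (h x * (f x ^- n.+1)%:E) =
   \int[lebR]_s \int[lebesgue_rV n]_z Phi n (s, z))%E.
Proof.
(* [Psi] is [Phi] in the coordinates [(s, x)] with [z = s *: x]; the power of [|s|] is the Jacobian
   of the slice. *)
pose Psi (p : mR * 'rV[R]_n) : \bar R :=
  ((`|p.1| ^+ n)%:E * (cone_weight n (p.1 * f p.2)%R * h p.2))%E.
have m1 : measurable_fun setT
    (fun p : mR * 'rV[R]_n => cone_weight n (p.1 * f p.2) * h p.2)%E.
  apply: emeasurable_funM; last exact: (measurableT_comp mh measurable_snd).
  apply: measurableT_comp; first exact: measurable_cone_weight.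
  apply: measurable_funM; first exact: measurable_fst.
  exact: (measurableT_comp mf measurable_snd).
have mPsi : measurable_fun setT Psi.
  apply: emeasurable_funM => //; apply/measurable_EFinP; apply: measurable_funX.
  by apply: measurableT_comp => //; exact: measurable_fst.
have Psi0 p : (0 <= Psi p)%E.
  by rewrite mule_ge0 ?lee_fin ?exprn_ge0// mule_ge0 ?cone_weight_ge0.
transitivity (\int[lebR]_s \int[lebesgue_rV n]_x Psi (s, x))%E; last first.
  apply: eq_integral => s _; have [s0|s0] := ltP 0 s; last first.
    apply: eq_integral => z _; rewrite /Psi /Phi /=.
    (* For [s <= 0] nothing contributes: [f] is positive wherever [h] is nonzero, so the weight is
       taken at a nonpositive argument. *)
    have E x : (cone_weight n (s * f x)%R * h x = 0)%E.
      have [->|/hf fx] := eqVneq (h x) 0%E; first by rewrite mule0.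
      by rewrite cone_weight_le0 ?mul0e// mulr_le0_ge0// ltW.
    by rewrite !E mule0.
  rewrite [RHS](integral_rV_scale n s _ s0); last 2 first.
  - apply: (measurableT_comp (measurable_cone n)); exact: pair1_measurable.
  - by move=> z; exact: cone_ge0.
  rewrite -ge0_integralZl; last 4 first.
  - exact: measurableT.
  - apply: (measurableT_comp (measurable_cone n)); apply: measurable_fun_pair => //.
    exact: measurable_scale.
  - by move=> x _; exact: cone_ge0.
  - by rewrite lee_fin exprn_ge0// ltW.
  apply: eq_integral => x _; rewrite /Psi /Phi /= gtr0_norm//.
  by rewrite scalerA mulVf ?scale1r// gt_eqF.
rewrite [RHS](fubini_tonelli Psi mPsi Psi0); apply: eq_integral => x _.
have [hx|hx] := eqVneq (h x) 0%E.
  rewrite hx mul0e; apply/esym; apply: integral0_eq => s _.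
  by rewrite /Psi /= hx !mule0.
rewrite -(integral_cone_weight n _ (hf x hx)) -ge0_integralZl; last 4 first.
- exact: measurableT.
- apply: emeasurable_funM.
    by apply/measurable_EFinP; apply: measurable_funX; exact: normr_measurable.
  apply: measurableT_comp; first exact: measurable_cone_weight.
  exact: measurable_funM.
- by move=> s _; rewrite mule_ge0 ?cone_weight_ge0// lee_fin exprn_ge0.
- exact: h0.
by apply: eq_integral => s _; rewrite /Psi /= muleC muleA.
Qed.

End cone.
End cone_integral.

(** * Affine functions under dilation, twist and insertion of a coordinate *)

Section affine_functions.
Context {R : realType}.

Lemma affine_scaleE {n} (f : affine R n) (a : R) x :
  f (a *: x) = a * (f x - aff_cst f) + aff_cst f.
Proof.
rewrite /affine_fun addrK mulr_sumr; congr (_ + _).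
by apply: eq_bigr => j _; rewrite mxE mulrCA.
Qed.

Lemma measurable_affine {n} (f : affine R n) : measurable_fun setT f.
Proof.
apply: measurable_funD => //; apply: measurable_sum => i.
by apply: measurable_funM => //; exact: measurable_coord.
Qed.

(** Where [twist_affE] evaluates at [twist_pt f x], this formula evaluates the twisted function at
    an arbitrary point, as the cone computations require. *)
Lemma twist_aff_funE {n} (f l : affine R n) x :
  twist_aff f l x =
  l x - aff_cst l - aff_cst l / aff_cst f * (f x - aff_cst f - 1).
Proof.
rewrite /affine_fun /= !addrK mulrBr mulr1 opprB addrCA addrC mulr_sumr.
rewrite -sumrB; congr (_ + _); apply: eq_bigr => j _.
by rewrite !mxE mulrBl mulrA.
Qed.

(** The twist of the constant 1 takes the value [1 / f x] at [twist_pt f x], so twisting by it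
    multiplies by [f x] again: the inverse of a twist is a twist. *)
Lemma twist_pt_aff1 {n} (f : affine R n) x : f 0 != 0 -> f x != 0 ->
  twist_pt (twist_aff f affine1) (twist_pt f x) = x.
Proof.
move=> f0 fx; rewrite {1}/twist_pt twist_affE// affine1E div1r invrK.
by rewrite scalerA divff// scale1r.
Qed.

Lemma rV_insert_affine {n} (l : affine R n.+1) k t y :
  l (rV_insert k (t, y)) =
  aff_lin l ord0 k * t + l (rV_insert k (0, y)).
Proof.
rewrite /affine_fun !(bigD1_ord k)//= !rV_insert_id/= mulr0 add0r -addrA.
by congr (_ + (_ + _)); apply: eq_bigr => i _; rewrite !rV_insert_lift.
Qed.

Lemma hyperplane_chartE {n} (l : affine R n.+1) k y :
  hyperplane_chart l k y =
  rV_insert k (- l (rV_insert k (0, y)) / aff_lin l ord0 k, y).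
Proof.
apply/rowP => j; rewrite !mxE; case: unliftP => //= _.
rewrite /affine_fun (bigD1_ord k)//= rV_insert_id/= mulr0 add0r.
by under [in RHS]eq_bigr do rewrite rV_insert_lift.
Qed.

End affine_functions.

(** * Lebesgue measure under the twist *)

Section projective_change_of_variables.
Context {R : realType}.
Local Notation mR := (measurableTypeR R).
Local Notation lebR := (@lebesgue_measure R).
Local Opaque lebesgue_rV.
Variables (n : nat) (f : affine R n) (g : 'rV[R]_n -> \bar R).
Hypothesis f0 : aff_cst f != 0.
Hypotheses (mg : measurable_fun setT g) (g0 : forall y, (0 <= g y)%E).
Hypothesis gf : forall y, g y != 0%E -> 0 < twist_aff f affine1 y.

(** The cut-off gives the positivity that [integral_cone] asks for; at [f x = 0] the convention
    [0^-1 = 0] would send [x] to the origin, where [g] may be nonzero. *)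
Definition twist_pullback (x : 'rV[R]_n) : \bar R :=
  if 0 < f x then g (twist_pt f x) else 0%E.
Local Notation h := twist_pullback.

Lemma measurable_twist_pullback : measurable_fun setT h.
Proof.
apply: measurable_fun_ifT => //.
  by apply: measurable_fun_ltr => //; exact: measurable_affine.
by apply: measurableT_comp => //; apply: measurable_scaleV => //; exact: measurable_affine.
Qed.

Lemma twist_pullback_ge0 x : (0 <= h x)%E.
Proof. by rewrite /h; case: ifP. Qed.

Lemma twist_pullback_gt0 x : h x != 0%E -> 0 < f x.
Proof. by rewrite /h; case: ifP => //; rewrite eqxx. Qed.

(* On the cones, the twist is the linear map (s, z) |-> (s f(z / s), z). *)
Lemma cone_twist w (s : R) z :
  let u := aff_cst f * s + (f z - aff_cst f) in
  (cone_weight w (s * f (s^-1 *: z))%R * h (s^-1 *: z)%R =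
   cone_weight w (u * 1)%R * g (u^-1 *: z)%R)%E.
Proof.
move=> u; rewrite mulr1.
have uE : s != 0 -> u = s * f (s^-1 *: z).
  by move=> s0; rewrite affine_scaleE /u; field.
have [/andP[s0 fs]|H] := boolP ((0 < s) && (0 < f (s^-1 *: z))).
  by rewrite /h fs uE ?gt_eqF// /twist_pt scalerA invfM [_^-1 * s^-1]mulrC.
(* Off the positive cone both sides vanish. On the right, [u > 0] and a nonzero value of [g] would
   force [s > 0] and then [f (s^-1 *: z) > 0]. *)
have -> : (cone_weight w (s * f (s^-1 *: z))%R * h (s^-1 *: z)%R = 0)%E.
  have [->|/twist_pullback_gt0 fx] := eqVneq (h (s^-1 *: z)) 0%E.
    by rewrite mule0.
  move: H; rewrite fx andbT -leNgt => s0.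
  by rewrite cone_weight_le0 ?mul0e// mulr_le0_ge0// ltW.
have [u0|u0] := leP u 0; first by rewrite cone_weight_le0// mul0e.
have [->|/gf] := eqVneq (g (u^-1 *: z)) 0%E; first by rewrite mule0.
have u_neq0 : u != 0 by rewrite gt_eqF.
rewrite twist_aff_funE affine1E /= affine_scaleE addrK.
(* The twisted constant 1, evaluated at [u^-1 *: z], is [s / u]; its positivity on the support of
   [g] gives [s > 0]. *)
have -> : 1 - 1 - 1 / aff_cst f * (u^-1 * (f z - aff_cst f) - 1) = s / u.
  rewrite /u in u_neq0 *; field. by rewrite f0 u_neq0.
rewrite pmulr_lgt0 ?invr_gt0// => s0.
by move: H u0; rewrite uE ?gt_eqF// pmulr_rgt0// s0 /= => /negPf ->.
Qed.

(** Both sides are cone integrals, for the constant 1 on the left and for [f] on the right. By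
    [cone_twist] they differ, at each fixed [z], by an affine substitution in [s] of slope
    [aff_cst f]. *)
Lemma integral_twist :
  (\int[lebesgue_rV n]_y g y =
   `|aff_cst f|%:E * \int[lebesgue_rV n]_x (h x * (f x ^- n.+1)%:E))%E.
Proof.
have m1 : measurable_fun setT (fun=> 1 : R) by move=> *; exact: measurable_cst.
transitivity (\int[lebesgue_rV n]_y (g y * (1 ^- n.+1)%:E))%E.
  by apply: eq_integral => y _; rewrite expr1n invr1 mule1.
rewrite (integral_cone n (fun=> 1) g)//.
rewrite (integral_cone n f h); last 4 first.
- exact: measurable_affine.
- exact: measurable_twist_pullback.
- exact: twist_pullback_ge0.
- exact: twist_pullback_gt0.
pose G (p : mR * 'rV[R]_n) := (cone_weight n (p.1 * 1)%R * g (p.1^-1 *: p.2)%R)%E.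
have mG : measurable_fun setT G by exact: (measurable_cone n (fun=> 1) g).
have G0 p : (0 <= G p)%E by rewrite mule_ge0// cone_weight_ge0.
have mF : measurable_fun setT (fun p : mR * 'rV[R]_n =>
    (aff_cst f * p.1 + (f p.2 - aff_cst f), p.2)).
  apply: measurable_fun_pair; last exact: measurable_snd.
  apply: measurable_funD.
    by apply: measurable_funM => //; exact: measurable_fst.
  apply: measurable_funB => //.
  exact: (measurableT_comp (measurable_affine f) measurable_snd).
pose H (p : mR * 'rV[R]_n) := G (aff_cst f * p.1 + (f p.2 - aff_cst f), p.2).
have mH : measurable_fun setT H by exact: measurableT_comp mG mF.
have H0 p : (0 <= H p)%E by exact: G0.
transitivity (`|aff_cst f|%:E * \int[lebR]_s \int[lebesgue_rV n]_z H (s, z))%E;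
  last first.
  congr (_ * _)%E; apply: eq_integral => s _; apply: eq_integral => z _.
  by rewrite cone_twist.
rewrite (fubini_tonelli H mH H0) [LHS](fubini_tonelli G mG G0).
rewrite -ge0_integralZl; last 4 first.
- exact: measurableT.
- exact: measurable_fun_fubini_tonelli_G.
- by move=> z _; exact: integral_ge0.
- by rewrite lee_fin.
apply: eq_integral => z _.
have mGz : measurable_fun [set: mR] (fun u => G (u, z)).
  by apply: (measurableT_comp mG); exact: pair2_measurable.
exact: (integral_affine_subst _ (f z - aff_cst f) _ f0 mGz (fun u => G0 (u, z))).
Qed.

End projective_change_of_variables.

(** * Hyperplane integrals as integrals over cones *)

Section hyperplane_integrals.
Context {R : realType}.
Local Notation mR := (measurableTypeR R).
Local Notation lebR := (@lebesgue_measure R).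
Local Opaque lebesgue_rV.

Lemma ge0_integral_facet_measure n (l : affine R n.+1) k (g : 'rV[R]_n.+1 -> \bar R) :
  [pick k | aff_lin l ord0 k != 0] = Some k ->
  measurable_fun setT g -> (forall y, 0 <= g y)%E ->
  (\int[facet_measure l]_x g x =
   (`|aff_lin l ord0 k|^-1)%:E * \int[lebesgue_rV n]_y g (hyperplane_chart l k y))%E.
Proof.
move=> kE mg g0.
have mc := measurable_hyperplane_chart l k.
pose mu : {measure set 'rV[R]_n.+1 -> \bar R} :=
  measure_function_pushforward__canonical__measure_function_Measure
    (lebesgue_rV n) mc.
have r0 : 0 <= `|aff_lin l ord0 k|^-1 by rewrite invr_ge0.
rewrite (@eq_measure_integral _ _ _ _ (mscale (NngNum r0) mu)); last first.
  by move=> A _ _; rewrite /= /facet_measure kE.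
rewrite ge0_integral_mscale//; congr (_ * _)%E.
by rewrite ge0_integral_pushforward.
Qed.

Lemma integral_facet_measure0 m (l : affine R m) (g : 'rV[R]_m -> \bar R) :
  aff_lin l = 0 -> (\int[facet_measure l]_x g x = 0)%E.
Proof.
move=> l0; rewrite (@eq_measure_integral _ _ _ _ mzero) ?integral_measure_zero//.
move=> A _ _; rewrite /= /facet_measure; case: pickP => // k.
by rewrite l0 mxE eqxx.
Qed.

Section slices.
Variables (n : nat) (l : affine R n.+1) (k : 'I_n.+1).
Variables (f : 'rV[R]_n.+1 -> R) (h : 'rV[R]_n.+1 -> \bar R).
Hypothesis lk : aff_lin l ord0 k != 0.
Hypotheses (mf : measurable_fun setT f) (mh : measurable_fun setT h).
Hypotheses (h0 : forall x, (0 <= h x)%E) (hf : forall x, h x != 0%E -> 0 < f x).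

Let Phi (s : R) z : \bar R :=
  (cone_weight n (s * f (s^-1 *: z))%R * h (s^-1 *: z)%R)%E.

(* The point over [y] of the cone on [l = 0] at height [s]. *)
Let pt (s : R) y : 'rV[R]_n.+1 :=
  rV_insert k (- (l (rV_insert k (0, y)) - aff_cst l + aff_cst l * s)
               / aff_lin l ord0 k, y).

Let measurable_pt : measurable_fun setT (fun p : mR * 'rV[R]_n => pt p.1 p.2).
Proof.
apply: (measurableT_comp (measurable_rV_insert k)).
apply: measurable_fun_pair; last exact: measurable_snd.
apply: measurable_funM => //; apply: measurableT_comp => //.
apply: measurable_funD; last by apply: measurable_funM => //; exact: measurable_fst.
apply: measurable_funB => //; apply: (measurableT_comp (measurable_affine l)).
apply: (measurableT_comp (measurable_rV_insert k)).
by apply: measurable_fun_pair => //; exact: measurable_snd.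
Qed.

Let measurable_Phi_pt :
  measurable_fun setT (fun p : mR * 'rV[R]_n => Phi p.1 (pt p.1 p.2)).
Proof.
have mp : measurable_fun setT (fun p : mR * 'rV[R]_n => (p.1 : mR, pt p.1 p.2)).
  by apply: measurable_fun_pair; [exact: measurable_fst|exact: measurable_pt].
exact: (measurableT_comp (measurable_cone _ f h mf mh n) mp).
Qed.

Let Phi_ge0 s z : (0 <= Phi s z)%E.
Proof. by rewrite mule_ge0// cone_weight_ge0. Qed.

(** The chart is affine, so the slice at height [s] of the cone over the hyperplane is again a graph
    over [y], and [integral_cone] applies in dimension [n] to [f] and [h] read in the chart. *)
Lemma integral_hyperplane_slice :
  (\int[lebesgue_rV n]_y (h (hyperplane_chart l k y) *
      (f (hyperplane_chart l k y) ^- n.+1)%:E) =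
   \int[lebesgue_rV n]_y \int[lebR]_s Phi s (pt s y))%E.
Proof.
have mc := measurable_hyperplane_chart l k.
rewrite (integral_cone n (f \o hyperplane_chart l k) (h \o hyperplane_chart l k));
  last 4 first.
- exact: measurableT_comp.
- exact: measurableT_comp.
- by move=> y; exact: h0.
- by move=> y; exact: hf.
rewrite -(fubini_tonelli _ measurable_Phi_pt (fun p => Phi_ge0 _ _)).
apply: eq_integral => s _; apply: eq_integral => y _ /=.
(* At height 0 the rescaling by [s^-1] is meaningless, but the weight vanishes there. *)
have [->|s0] := eqVneq s 0.
  by rewrite /Phi !mul0r cone_weight_le0// !mul0e.
suff -> : hyperplane_chart l k (s^-1 *: y) = s^-1 *: pt s y by [].
rewrite hyperplane_chartE /pt.
have -> : rV_insert k (0, s^-1 *: y) = s^-1 *: rV_insert k (0, y).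
  by apply/rowP => j; rewrite !mxE; case: unliftP => [i _|_] /=; rewrite ?mxE ?mulr0.
rewrite affine_scaleE.
apply/rowP => j; rewrite !mxE; case: unliftP => [i _|_] /=; first by rewrite mxE.
by field; rewrite lk s0.
Qed.

Hypothesis l0 : aff_cst l != 0.

(* When [l = 0] misses the origin, its cone is a graph over the space itself,
   which no longer refers to the chart [k]. *)
Lemma integral_hyperplane_graph :
  ((`|aff_lin l ord0 k|^-1)%:E *
   \int[lebesgue_rV n]_y (h (hyperplane_chart l k y) *
      (f (hyperplane_chart l k y) ^- n.+1)%:E) =
   (`|aff_cst l|^-1)%:E * \int[lebesgue_rV n.+1]_z
      Phi (- (l z - aff_cst l) / aff_cst l) z)%E.
Proof.
pose H z := Phi (- (l z - aff_cst l) / aff_cst l) z.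
have mH : measurable_fun setT H.
  have mp : measurable_fun setT (fun z : 'rV[R]_n.+1 =>
      ((- (l z - aff_cst l) / aff_cst l) : mR, z)).
    apply: measurable_fun_pair => //; apply: measurable_funM => //.
    apply: measurableT_comp => //; apply: measurable_funB => //.
    exact: measurable_affine.
  exact: (measurableT_comp (measurable_cone _ f h mf mh n) mp).
have H0 z : (0 <= H z)%E by exact: Phi_ge0.
have mHi : measurable_fun setT (H \o rV_insert k).
  exact: (measurableT_comp mH (measurable_rV_insert k)).
rewrite integral_hyperplane_slice.
transitivity ((`|aff_lin l ord0 k|^-1)%:E * \int[lebesgue_rV n]_y
    (`|aff_lin l ord0 k / aff_cst l|%:E * \int[lebR]_t H (rV_insert k (t, y))))%E.
  congr (_ * _)%E; apply: eq_integral => y _.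
  have mPy : measurable_fun [set: mR] (fun s => Phi s (pt s y)).
    exact: (measurableT_comp measurable_Phi_pt (pair2_measurable y)).
  (* On the cone [l z - aff_cst l + aff_cst l * s = 0], so for fixed [y] the height [s] is affine in
     the coordinate [t] at place [k], with this slope; [t] replaces [s] as the variable. *)
  have ak0 : - (aff_lin l ord0 k / aff_cst l) != 0.
    by rewrite oppr_eq0 mulf_neq0// invr_neq0.
  rewrite (integral_affine_subst _
    (- (l (rV_insert k (0, y)) - aff_cst l) / aff_cst l) _ ak0 mPy
    (fun s => Phi_ge0 s _)) normrN.
  congr (_ * _)%E; apply: eq_integral => t _; rewrite /H.
  have -> : - (l (rV_insert k (t, y)) - aff_cst l) / aff_cst l =
      - (aff_lin l ord0 k / aff_cst l) * t +
      - (l (rV_insert k (0, y)) - aff_cst l) / aff_cst l.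
    by rewrite rV_insert_affine; field.
  congr Phi; rewrite /pt; congr (rV_insert k (_, y)).
  by field; rewrite lk l0.
rewrite ge0_integralZl; last 4 first.
- exact: measurableT.
- exact: (measurable_fun_fubini_tonelli_G _ mHi (fun p => H0 _)).
- by move=> y _; exact: integral_ge0.
- by rewrite lee_fin.
(* The slope cancels the normalising factor of the facet measure, which removes the dependence on
   [k]. *)
rewrite muleA -EFinM normrM normfV mulrA mulVf ?normr_eq0// mul1r.
congr (_ * _)%E; rewrite (integral_rV_insert _ k _ mH H0).
by rewrite (fubini_tonelli _ mHi (fun p => H0 _)).
Qed.

End slices.
End hyperplane_integrals.

(** * Facet measures under the twist *)

Section twist_facet.
Context {R : realType}.
Local Notation mR := (measurableTypeR R).
Local Notation lebR := (@lebesgue_measure R).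
Local Opaque lebesgue_rV.

Lemma twist_aff_cst0 m (f l : affine R m) : aff_cst l = 0 -> twist_aff f l = l.
Proof.
by case: l => a c /= ->; rewrite /twist_aff /= mul0r scale0r subr0.
Qed.

Lemma pick_aff_lin m (l : affine R m) : aff_lin l != 0 ->
  exists2 k, [pick k | aff_lin l ord0 k != 0] = Some k & aff_lin l ord0 k != 0.
Proof.
case: pickP => [k lk _|lE /eqP[]]; first by exists k.
by apply/rowP => k; rewrite mxE; move/negbFE/eqP: (lE k).
Qed.

Lemma integral_facet_twist m (f l : affine R m) (g : 'rV[R]_m -> \bar R) :
  aff_cst f != 0 -> measurable_fun setT g -> (forall y, 0 <= g y)%E ->
  (forall y, g y != 0%E -> 0 < twist_aff f affine1 y) ->
  (forall y, g y != 0%E -> twist_aff f l y = 0) ->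
  (\int[facet_measure (twist_aff f l)]_y g y =
   `|aff_cst f|%:E *
   \int[facet_measure l]_x (twist_pullback m f g x * (f x ^- m)%:E))%E.
Proof.
case: m f l g => [|n] f l g f0 mg g0 gf gl.
  (* In dimension 0 every linear part is zero, and so are both facet measures. *)
  rewrite !integral_facet_measure0 ?mule0//; by apply/rowP => -[].
pose h := twist_pullback n.+1 f g; rewrite -/h.
have mh : measurable_fun setT h by exact: measurable_twist_pullback.
have h0 x : (0 <= h x)%E by exact: twist_pullback_ge0.
have hf x : h x != 0%E -> 0 < f x by exact: twist_pullback_gt0.
have hE x w z : (cone_weight w (x * f (x^-1 *: z))%R * h (x^-1 *: z)%R)%E = _ :=
  cone_twist n.+1 f g f0 gf w x z.
have m1 : measurable_fun [set: 'rV[R]_n.+1] (fun=> 1 : R).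
  by move=> *; exact: measurable_cst.
have mhf : measurable_fun setT (fun x => h x * (f x ^- n.+1)%:E)%E.
  apply: emeasurable_funM => //; apply/measurable_EFinP.
  apply: (measurableT_comp measurable_inv); apply: measurable_funX.
  exact: measurable_affine.
have hf0 x : (0 <= h x * (f x ^- n.+1)%:E)%E.
  have [->|/hf fx] := eqVneq (h x) 0%E; first by rewrite mul0e.
  by rewrite mule_ge0// lee_fin invr_ge0 exprn_ge0// ltW.
have g1 y : (g y = g y * (1 ^- n.+1)%:E)%E by rewrite expr1n invr1 mule1.
(* A hyperplane through the origin is its own twist, so both sides use the same chart. Otherwise the
   charts of [l] and of its twist may differ, and the chart-free graph form is used. *)
have [l0|l0] := eqVneq (aff_cst l) 0.
  rewrite twist_aff_cst0//.
  have [a0|/pick_aff_lin[k kE lk]] := eqVneq (aff_lin l) 0.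
    by rewrite !integral_facet_measure0// mule0.
  rewrite (ge0_integral_facet_measure _ _ _ _ kE mg g0).
  rewrite (ge0_integral_facet_measure _ _ _ _ kE mhf hf0).
  rewrite muleCA; congr (_ * _)%E.
  under eq_integral do rewrite g1.
  rewrite (integral_hyperplane_slice n l k (fun=> 1) g lk m1 mg g0)//.
  rewrite (integral_hyperplane_slice n l k f h lk (measurable_affine f) mh h0 hf).
  rewrite l0.
  (* With [aff_cst l = 0] the point of the cone over [y] does not depend on the height, so the twist
     is a substitution in [s] alone. *)
  pose pt y : 'rV[R]_n.+1 :=
    rV_insert k (- (l (rV_insert k (0, y)) - 0) / aff_lin l ord0 k, y).
  pose G (y : 'rV[R]_n) (u : mR) : \bar R :=
    (cone_weight n (u * 1)%R * g (u^-1 *: pt y)%R)%E.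
  pose F y (s : mR) : mR := aff_cst f * s + (f (pt y) - aff_cst f).
  have mpt : measurable_fun setT pt.
    apply: (measurableT_comp (measurable_rV_insert k)).
    apply: measurable_fun_pair => //; apply: measurable_funM => //.
    apply: measurableT_comp => //; apply: measurable_funB => //.
    apply: (measurableT_comp (measurable_affine l)).
    apply: (measurableT_comp (measurable_rV_insert k)).
    exact: measurable_fun_pair.
  have G0 y u : (0 <= G y u)%E by rewrite mule_ge0// cone_weight_ge0.
  have mpair : measurable_fun setT
      (fun p : 'rV[R]_n * mR => (p.2 : mR, pt p.1 : 'rV[R]_n.+1)).
    apply: measurable_fun_pair; first exact: measurable_snd.
    exact: (measurableT_comp mpt measurable_fst).
  have mG : measurable_fun setT (fun p : 'rV[R]_n * mR => G p.1 p.2).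
    exact: (measurableT_comp (measurable_cone _ _ g m1 mg n) mpair).
  have mF : measurable_fun setT (fun p : 'rV[R]_n * mR => (p.1, F p.1 p.2)).
    apply: measurable_fun_pair; first exact: measurable_fst.
    apply: measurable_funD.
      by apply: measurable_funM => //; exact: measurable_snd.
    apply: measurable_funB => //.
    exact: (measurableT_comp (measurable_affine f) (measurableT_comp mpt measurable_fst)).
  have mGF : measurable_fun setT (fun p : 'rV[R]_n * mR => G p.1 (F p.1 p.2)).
    exact: (measurableT_comp mG mF).
  transitivity (\int[lebesgue_rV n]_y \int[lebR]_u G y u)%E.
    apply: eq_integral => y _; apply: eq_integral => s _.
    by rewrite /G /pt mul0r addr0.
  transitivity (`|aff_cst f|%:E *
      \int[lebesgue_rV n]_y \int[lebR]_s G y (F y s))%E; last first.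
    congr (_ * _)%E; apply: eq_integral => y _; apply: eq_integral => s _.
    by rewrite hE mul0r addr0.
  rewrite -ge0_integralZl; last 4 first.
  - exact: measurableT.
  - exact: (measurable_integral_snd lebR _ mGF (fun p => G0 _ _)).
  - by move=> y _; exact: integral_ge0.
  - by rewrite lee_fin.
  apply: eq_integral => y _.
  have mGy : measurable_fun [set: mR] (G y).
    exact: (measurableT_comp mG (pair1_measurable y)).
  exact: (integral_affine_subst _ (f (pt y) - aff_cst f) _ f0 mGy (G0 y)).
have c0 : aff_cst (twist_aff f l) != 0 by rewrite /= mulf_neq0// invr_neq0.
have [a0|/pick_aff_lin[k kE lk]] := eqVneq (aff_lin l) 0.
  rewrite [X in (_ * X)%E]integral_facet_measure0// mule0.
  (* The twist of a constant [l] is [aff_cst l] times the twisted constant 1, which is positive on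
     the support of [g]; as the twist of [l] vanishes there, the support is empty. *)
  apply: integral0_eq => y _; apply/eqP/negPn/negP => gy.
  have := gl y gy; have := gf y gy; rewrite !twist_aff_funE affine1E /=.
  rewrite (_ : l y = aff_cst l); last first.
    by rewrite /affine_fun a0 big1 ?add0r// => j _; rewrite mxE mul0r.
  rewrite !subrr !sub0r => fy /eqP; rewrite oppr_eq0 -mulrA mulf_eq0 (negPf l0) /=.
  by move=> /eqP E; move: fy; rewrite -mulrA E mulr0 oppr0 ltxx.
have [a0|/pick_aff_lin[k' kE' lk']] := eqVneq (aff_lin (twist_aff f l)) 0.
  rewrite [LHS]integral_facet_measure0//.
  rewrite integral0_eq ?mule0// => x _.
  (* A constant twist equals its nonzero constant term [c0] everywhere, which leaves no room for the
     support of [g]. *)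
  have gE y : g y = 0%E.
    apply/eqP/negPn/negP => /gl /eqP.
    rewrite /affine_fun a0 big1 ?add0r ?(negPf c0)// => j _.
    by rewrite mxE mul0r.
  by rewrite /h /twist_pullback gE; case: ifP; rewrite mul0e.
rewrite (ge0_integral_facet_measure _ _ _ _ kE mhf hf0).
rewrite (ge0_integral_facet_measure _ _ _ _ kE' mg g0).
under [in LHS]eq_integral do rewrite g1.
rewrite (integral_hyperplane_graph n _ k' (fun=> 1) g lk' m1 mg g0)//.
rewrite (integral_hyperplane_graph n l k f h lk (measurable_affine f) mh h0 hf l0).
rewrite muleA -EFinM; congr (_%:E * _)%E.
  by rewrite /= normrM normfV invfM invrK mulrC.
apply: eq_integral => z _; rewrite hE.
(* The height of [z] on the twisted cone is the image under the twist of its height on the original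
   one. *)
suff -> : - (twist_aff f l z - aff_cst (twist_aff f l)) / aff_cst (twist_aff f l) =
  aff_cst f * (- (l z - aff_cst l) / aff_cst l) + (f z - aff_cst f) by [].
by rewrite twist_aff_funE /=; field; rewrite f0 l0.
Qed.

End twist_facet.

(** * Real-valued integrals and the Donaldson-Futaki functional *)

Section twist_Rintegral.
Context {R : realType}.
Local Opaque lebesgue_rV.

(** [fine] sends both infinities to 0 and a positive factor preserves them, so real integrals can be
    compared before integrability is known. *)
Lemma fine_mulBr (c : R) (a b : \bar R) : 0 < c -> (0 <= a)%E -> (0 <= b)%E ->
  fine (c%:E * a - c%:E * b)%E = c * fine (a - b)%E.
Proof.
move=> c0; case: a => [a| |]//; case: b => [b| |]// _ _ /=.
- by rewrite mulrBr.
- by rewrite gt0_muley ?lte_fin//= mulr0.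
- by rewrite gt0_muley ?lte_fin//= mulr0.
- by rewrite gt0_muley ?lte_fin//= mulr0.
Qed.

Lemma measurable_affine_level m (l : affine R m) :
  measurable [set x : 'rV[R]_m | l x = 0].
Proof.
rewrite -[X in measurable X]setTI.
exact: (measurable_affine l measurableT [set 0] (measurable_set1 0)).
Qed.

Lemma measurable_zero_face m (D : set 'rV[R]_m) l :
  measurable D -> measurable (zero_face D l).
Proof. by move=> mD; apply: measurableI => //; exact: measurable_affine_level. Qed.

Section twist.
Variables (m : nat) (D : set 'rV[R]_m) (f : affine R m).
Hypotheses (f0 : aff_cst f != 0) (fD : forall x, D x -> 0 < f x).

(** The inverse twist turns the image of [D] into a preimage, from which measurability follows. *)
Lemma twist_setP y :
  twist_set f D y <-> 0 < twist_aff f affine1 y /\ D (twist_pt (twist_aff f affine1) y).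
Proof.
have f00 : f 0 != 0 by rewrite affine0E.
split=> [[x Dx <-]|[fy Dy]].
  have fx : f x != 0 by rewrite gt_eqF// fD.
  by rewrite twist_pt_aff1// twist_affE// affine1E div1r invr_gt0 fD.
exists (twist_pt (twist_aff f affine1) y) => //.
rewrite /twist_pt affine_scaleE; move: fy; rewrite twist_aff_funE affine1E /=.
rewrite subrr sub0r; set a := - _ => a0.
have aE : a = (1 + aff_cst f - f y) / aff_cst f by rewrite /a; field.
(* The value of [f] at the candidate preimage [a^-1 *: y] is [a^-1], so the twist brings it back to
   [y]. *)
have -> : a^-1 * (f y - aff_cst f) + aff_cst f = a^-1.
  apply: (mulfI (lt0r_neq0 a0)); rewrite mulrDr mulVKf ?gt_eqF// mulfV ?gt_eqF//.
  by rewrite aE divfK//; ring.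
by rewrite invrK scalerA mulfV ?scale1r// gt_eqF.
Qed.

Lemma twist_pt_inj x x' : 0 < f x -> 0 < f x' -> twist_pt f x = twist_pt f x' -> x = x'.
Proof.
move=> fx fx' E; have f00 : f 0 != 0 by rewrite affine0E.
by rewrite -(twist_pt_aff1 f x f00) ?gt_eqF// E twist_pt_aff1// gt_eqF.
Qed.

Lemma twist_set_pt x : 0 < f x -> twist_set f D (twist_pt f x) -> D x.
Proof. by move=> fx [x' Dx' /twist_pt_inj <-//]; exact: fD. Qed.

Lemma measurable_twist_set : measurable D -> measurable (twist_set f D).
Proof.
move=> mD.
have -> : twist_set f D = [set y | 0 < twist_aff f affine1 y] `&`
    (twist_pt (twist_aff f affine1) @^-1` D).
  by apply/seteqP; split => y; rewrite twist_setP.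
apply: measurableI.
  rewrite -[X in measurable X]setTI.
  have -> : [set y | 0 < twist_aff f affine1 y] =
      twist_aff f affine1 @^-1` [set` `]0, +oo[].
    by apply/seteqP; split => y /=; rewrite in_itv /= andbT.
  exact: measurable_affine.
rewrite -[X in measurable X]setTI.
have : measurable_fun setT (twist_pt (twist_aff f affine1)).
  by apply: measurable_scaleV => //; exact: measurable_affine.
exact.
Qed.

Lemma zero_face_twist l :
  zero_face (twist_set f D) (twist_aff f l) = twist_set f (zero_face D l).
Proof.
have f00 : f 0 != 0 by rewrite affine0E.
apply/seteqP; split=> y /=.
  move=> [[x Dx <-]] /=; have fx : f x != 0 by rewrite gt_eqF// fD.
  rewrite twist_affE// => /eqP; rewrite mulf_eq0 invr_eq0 (negPf fx).
  by rewrite orbF => /eqP lx; exists x.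
move=> [x [Dx /= lx] <-]; split; first by exists x.
have fx : f x != 0 by rewrite gt_eqF// fD.
by rewrite /= twist_affE// lx mul0r.
Qed.

(** Common to the interior, with Lebesgue measure and [w = m + 1], and to the facets, with facet
    measures and [w = m]. The nonnegative formula is applied to the positive and negative parts of
    [g], extended by zero. *)
Lemma Rintegral_twist_set (mu nu : {measure set 'rV[R]_m -> \bar R}) w
    (g : 'rV[R]_m -> R) :
  (forall k : 'rV[R]_m -> \bar R, measurable_fun setT k ->
     (forall y, 0 <= k y)%E -> (forall y, k y != 0%E -> twist_set f D y) ->
     (\int[nu]_y k y =
      `|aff_cst f|%:E * \int[mu]_x (twist_pullback m f k x * (f x ^- w)%:E))%E) ->
  measurable D -> measurable_fun setT g ->
  \int[nu]_(y in twist_set f D) g y =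
  `|aff_cst f| * \int[mu]_(x in D) (g (twist_pt f x) / f x ^+ w).
Proof.
move=> munu mD mg; rewrite /Rintegral.
have mE := measurable_twist_set mD.
have ge0_E (k : 'rV[R]_m -> \bar R) : measurable_fun setT k ->
    (forall y, 0 <= k y)%E ->
    (\int[nu]_(y in twist_set f D) k y = `|aff_cst f|%:E *
     \int[mu]_(x in D) (k (twist_pt f x) * (f x ^- w)%:E))%E.
  move=> mk k0; rewrite integral_mkcond munu.
  - congr (_ * _)%E; rewrite [RHS]integral_mkcond; apply: eq_integral => x _.
    rewrite /twist_pullback !patchE; case: ifPn => [fx|fx].
      have [/set_mem Dx|Dx] := boolP (x \in D).
        by rewrite mem_set//; exists x.
      rewrite ifN ?mul0e//; apply: contra Dx => /set_mem Tx.
      by apply: mem_set; exact: twist_set_pt.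
    by rewrite mul0e ifN//; apply: contra fx => /set_mem /fD.
  - apply/(measurable_restrictT _ mE); exact: measurable_funS mk.
  - by move=> y; rewrite patchE; case: ifP.
  - by move=> y; rewrite patchE; case: ifPn => [/set_mem//|]; rewrite eqxx.
have mG : measurable_fun setT (EFin \o g) by exact/measurable_EFinP.
rewrite integralE [in RHS]integralE.
rewrite !ge0_E//; last 2 first.
- exact: measurable_funeneg.
- exact: measurable_funepos.
rewrite fine_mulBr ?normr_gt0//; last 2 first.
- apply: integral_ge0 => x Dx; rewrite mule_ge0// lee_fin invr_ge0 exprn_ge0//.
  by rewrite ltW// fD.
- apply: integral_ge0 => x Dx; rewrite mule_ge0// lee_fin invr_ge0 exprn_ge0//.
  by rewrite ltW// fD.
congr (_ * fine (_ - _)%E); apply: eq_integral => x /set_mem /fD fx.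
  have fw : 0 <= f x ^- w by rewrite invr_ge0 exprn_ge0// ltW.
  rewrite !funeposE /= -!EFin_max -EFinM; congr EFin.
  by rewrite maxr_pMl// mul0r.
have fw : 0 <= f x ^- w by rewrite invr_ge0 exprn_ge0// ltW.
rewrite !funenegE /= -!EFin_max -EFinM; congr EFin.
by rewrite maxr_pMl// mul0r mulNr.
Qed.

End twist.

Section DF.
Variables (m d : nat) (D : set 'rV[R]_m) (L : 'I_d -> affine R m).
Variable f : affine R m.
Hypotheses (f0 : 0 < aff_cst f) (fD : forall x, D x -> 0 < f x).
Hypothesis mD : measurable D.

(** This is where the weight [m + 2] is forced: [f ^+ m.+1] on the boundary is one factor from [psi]
    and [f ^+ m] from the facet measure, while [f ^+ (m + 3)] inside is one factor each from [psi]
    and [zeta] and [f ^+ m.+1] from Lebesgue measure. The function [psi0] is a measurable stand-in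
    for [psi], which matters only on the twisted set. *)
Lemma DF_wrt_twist (zeta : affine R m) (phi psi psi0 : 'rV[R]_m -> R) :
  measurable_fun setT psi0 ->
  (forall y, twist_set f D y -> psi y = psi0 y) ->
  (forall x, D x -> psi (twist_pt f x) = phi x / f x) ->
  DF_wrt (twist_set f D) (twist_labels f L) (twist_aff f zeta) affine1 0 psi =
  aff_cst f * DF_wrt D L zeta f (m + 2)%:R phi.
Proof.
move=> mpsi psiE phiE.
have fn0 : aff_cst f != 0 by rewrite gt_eqF.
have f00 : f 0 != 0 by rewrite affine0E.
have phiE0 x : D x -> psi0 (twist_pt f x) = phi x / f x.
  by move=> Dx; rewrite -psiE ?phiE//; exists x.
have powE x k : D x -> f x `^ k%:R = f x ^+ k.
  by move=> Dx; rewrite powR_mulrn// ltW// fD.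
rewrite /DF_wrt mulrBr [in RHS]mulrCA; congr (2 * _ - _).
  rewrite /boundary_integral mulr_sumr; apply: eq_bigr => i _.
  rewrite /twist_labels zero_face_twist//.
  have fZ x : zero_face D (L i) x -> 0 < f x by case=> /fD.
  rewrite -(gtr0_norm f0).
  transitivity (`|aff_cst f| * \int[facet_measure (L i)]_(x in zero_face D (L i))
      (psi0 (twist_pt f x) / f x ^+ m)); last first.
    congr (_ * _); apply: eq_Rintegral => x /set_mem [Dx _].
    rewrite phiE0// (_ : (m + 2)%:R - 1 = m.+1%:R); last by rewrite addn2 -natr1 addrK.
    by rewrite powE// exprS invfM mulrA.
  rewrite -(Rintegral_twist_set _ _ _ fn0 fZ _ (facet_measure (twist_aff f (L i)))).
  - apply: eq_Rintegral => y /set_mem; rewrite -zero_face_twist// => -[Ey _].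
    by rewrite affine1E powR1 divr1 psiE.
  - move=> k mk k0 kE; apply: integral_facet_twist => // y /kE.
      by move/(twist_setP _ _ _ fn0 fZ) => -[].
    by rewrite -zero_face_twist// => -[].
  - exact: measurable_zero_face.
  - exact: mpsi.
rewrite -(gtr0_norm f0).
transitivity (`|aff_cst f| * \int[lebesgue_rV m]_(x in D)
    (psi0 (twist_pt f x) * twist_aff f zeta (twist_pt f x) / f x ^+ m.+1)); last first.
  congr (_ * _); apply: eq_Rintegral => x /set_mem Dx.
  have fx : f x != 0 by rewrite gt_eqF// fD.
  rewrite phiE0// twist_affE// natr1 powE// addn2 !exprS.
  by field; rewrite expf_neq0 ?fx.
rewrite -(Rintegral_twist_set _ _ _ fn0 fD _ (lebesgue_rV m) m.+1
  (fun y => psi0 y * twist_aff f zeta y)).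
- by apply: eq_Rintegral => y /set_mem Ey; rewrite affine1E powR1 divr1 psiE.
- move=> k mk k0 kE; apply: integral_twist => // y /kE.
  by move/(twist_setP _ _ _ fn0 fD) => -[].
- exact: mD.
- by apply: measurable_funM => //; exact: measurable_affine.
Qed.

End DF.
End twist_Rintegral.

(** * Uniqueness of the extremal affine function *)

Section uniqueness.
Context {R : realType} {m : nat}.
Local Opaque lebesgue_rV.

Lemma continuous_affine (l : affine R m) : continuous (l : 'rV[R]_m -> R).
Proof.
have cs (s : seq 'I_m) :
    continuous (fun x : 'rV[R]_m => \sum_(j <- s) aff_lin l ord0 j * x ord0 j).
  elim: s => [|j s IH].
    by under eq_fun do rewrite big_nil; exact: cst_continuous.
  under eq_fun do rewrite big_cons; move=> x.
  have cj : {for x, continuous (fun y : 'rV[R]_m => y ord0 j)}.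
    exact: coord_continuous.
  have c1 : {for x, continuous (fun y : 'rV[R]_m => aff_lin l ord0 j * y ord0 j)}.
    by apply: continuousM => //; exact: cst_continuous.
  exact: (continuousD c1 (IH x)).
by move=> x; apply: continuousD; [exact: cs|exact: cst_continuous].
Qed.

Lemma compact_continuous_bounded (D : set 'rV[R]_m) (g : 'rV[R]_m -> R) :
  compact D -> {in D, continuous g} ->
  exists2 M, 0 <= M & forall x, D x -> `|g x| <= M.
Proof.
move=> cD cg.
have /compact_bounded : compact (g @` D).
  by apply: continuous_compact => //; exact: continuous_in_subspaceT.
move=> [M [_ /(_ (Num.max 0 M + 1))]].
rewrite ltr_pwDr ?le_max ?lexx ?orbT// => /(_ isT) gM.
exists (Num.max 0 M + 1) => [|x Dx]; first by rewrite addr_ge0// le_max lexx.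
by apply: gM; exists x.
Qed.

Lemma compact_lebesgue_rV_lty (D : set 'rV[R]_m) :
  measurable D -> compact D -> (lebesgue_rV m D < +oo)%E.
Proof.
move=> mD cD.
have /choice[M HM] (i : 'I_m) :
    exists M, 0 <= M /\ forall x : 'rV[R]_m, D x -> `|x ord0 i| <= M.
  have [|M M0 HM] := compact_continuous_bounded D (fun x => x ord0 i) cD.
    by move=> x _; exact: coord_continuous.
  by exists M.
pose a : 'rV[R]_m := \row_i (- M i); pose b : 'rV[R]_m := \row_i M i.
apply: (@le_lt_trans _ _ (lebesgue_rV m (rV_box a b))).
  apply: le_measure; rewrite ?inE//; first exact: measurable_rV_box.
  by move=> x Dx i; rewrite !mxE in_itv /= -ler_norml; apply: (HM i).2.
rewrite lebesgue_rV_box ?ltry// => i; rewrite !mxE.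
by have := (HM i).1; lra.
Qed.

Lemma nbhs_rV_box (p : 'rV[R]_m) (U : set 'rV[R]_m) : nbhs p U ->
  exists2 e, 0 < e &
    rV_box (p - const_mx e) (p + const_mx e) `<=` U.
Proof.
move=> /nbhs_ballP[e /= e0 eU]; exists (e / 2); first by rewrite divr_gt0.
move=> x xp; apply: eU; split => // i j; rewrite (ord1 i) /ball /= distrC.
have := xp j; rewrite in_itv /= !mxE ltr_norml => /andP[]; lra.
Qed.

Lemma nbhs_lebesgue_rV_gt0 (p : 'rV[R]_m) (U N : set 'rV[R]_m) :
  nbhs p U -> U `<=` N -> measurable N -> (0 < lebesgue_rV m N)%E.
Proof.
move=> /nbhs_rV_box[e e0 eU] UN mN.
apply: (@lt_le_trans _ _
    (lebesgue_rV m (rV_box (p - const_mx e) (p + const_mx e)))); last first.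
  apply: le_measure; rewrite ?inE//; first exact: measurable_rV_box.
  exact: subset_trans UN.
rewrite lebesgue_rV_box => [|i]; last by rewrite !mxE; lra.
by rewrite lte_fin prodr_gt0// => i _; rewrite !mxE; lra.
Qed.

(** Comparing the centre of a small box with a shift along each axis isolates the linear
    coefficients one at a time. *)
Lemma affine_eq0 (l : affine R m) (U : set 'rV[R]_m) (p : 'rV[R]_m) :
  nbhs p U -> (forall x, U x -> l x = 0) -> l = Affine 0 0.
Proof.
move=> /nbhs_rV_box[e e0 eU] lU.
have lp : l p = 0.
  by apply: lU; apply: eU => i; rewrite in_itv /= !mxE; lra.
have lin0 : aff_lin l = 0.
  apply/rowP => j; rewrite mxE; apply: (mulIf (lt0r_neq0 e0)); rewrite mul0r.
  rewrite -[aff_lin l 0 j]/(aff_lin l ord0 j).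
  have : l (p + e *: delta_mx ord0 j) = l p.
    rewrite lp; apply: lU; apply: eU => i; rewrite in_itv /= !mxE eqxx /=.
    by case: eqP => _ /=; lra.
  rewrite /affine_fun (bigD1 j)//= [in RHS](bigD1 j)//= !mxE !eqxx mulr1 mulrDr.
  under eq_bigr => i ij do rewrite !mxE (negPf ij) andbF mulr0 addr0.
  lra.
move: lp; rewrite /affine_fun lin0 big1 ?add0r => [c0|i _]; last first.
  by rewrite mxE mul0r.
by case: (l) lin0 c0 => a c /= -> ->.
Qed.

Lemma integrable_affine_quot (D : set 'rV[R]_m) (f a b : affine R m) n :
  compact D -> measurable D -> (forall x, D x -> 0 < f x) ->
  (lebesgue_rV m).-integrable D (EFin \o (fun x => a x / f x ^+ n * b x)).
Proof.
move=> cD mD fD; apply: measurable_bounded_integrable => //.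
- exact: compact_lebesgue_rV_lty.
- apply: measurable_funTS.
  apply: measurable_funM; last exact: measurable_affine.
  apply: measurable_funM; first exact: measurable_affine.
  apply: (measurableT_comp measurable_inv); apply: measurable_funX.
  exact: measurable_affine.
have [|M M0 HM] := compact_continuous_bounded D
    (fun x => a x / f x ^+ n * b x) cD.
  move=> x /set_mem /fD fx.
  have fn0 : f x ^+ n != 0 by rewrite expf_neq0// gt_eqF.
  have cf : {for x, continuous (fun y => f y ^+ n)}.
    apply: (@continuous_comp _ _ _ (f : 'rV[R]_m -> R) (fun t => t ^+ n)).
      exact: continuous_affine.
    exact: exprn_continuous.
  apply: (@continuousM R _ (fun y => a y / f y ^+ n) b).
    apply: (@continuousM R _ a (fun y => (f y ^+ n)^-1)); last exact: continuousV.
    exact: continuous_affine.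
  exact: continuous_affine.
exists M; split; first exact: num_real.
by move=> K MK x Dx; rewrite /= (le_trans (HM _ Dx))// ltW.
Qed.

(** The difference [l] of two candidates is itself a test function: testing both against it gives
    integral zero for [l ^+ 2 / f ^+ n.+1]. Hence [l] vanishes almost everywhere on [D], by
    continuity on the interior, and so identically. *)
Lemma extremal_affine_unique (D : set 'rV[R]_m) d (L : 'I_d -> affine R m)
    (f zeta zeta' : affine R m) n :
  compact D -> interior D !=set0 -> measurable D ->
  (forall x, D x -> 0 < f x) ->
  (forall l : affine R m, DF_wrt D L zeta f n%:R l = 0) ->
  (forall l : affine R m, DF_wrt D L zeta' f n%:R l = 0) -> zeta = zeta'.
Proof.
move=> cD [p Dp] mD fD H H'.
pose l := Affine (aff_lin zeta - aff_lin zeta') (aff_cst zeta - aff_cst zeta').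
have lE x : l x = zeta x - zeta' x.
  rewrite /affine_fun /= opprD addrACA -sumrB; congr (_ + _).
  by apply: eq_bigr => j _; rewrite !mxE mulrBl.
have int0 : \int[lebesgue_rV m]_(x in D) (l x / f x ^+ n.+1 * l x) = 0.
  have : \int[lebesgue_rV m]_(x in D) (l x / f x ^+ n.+1 * zeta x) =
         \int[lebesgue_rV m]_(x in D) (l x / f x ^+ n.+1 * zeta' x).
    have powE (z : affine R m) :
      \int[lebesgue_rV m]_(x in D) (l x / f x ^+ n.+1 * z x) =
      \int[lebesgue_rV m]_(x in D) (l x / f x `^ (n%:R + 1) * z x).
      apply: eq_Rintegral => x /set_mem /fD fx.
      by rewrite natr1 powR_mulrn// ltW.
    by rewrite !powE -(subr0_eq (H l)) -(subr0_eq (H' l)).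
  move/eqP; rewrite -subr_eq0 -RintegralB//; try exact: integrable_affine_quot.
  by move=> /eqP <-; apply: eq_Rintegral => x _; rewrite -mulrBr -lE.
have il := integrable_affine_quot D f l l n.+1 cD mD fD.
have {}int0 : (\int[lebesgue_rV m]_(x in D) (l x / f x ^+ n.+1 * l x)%:E = 0)%E.
  rewrite -[LHS]fineK; last exact: integrable_fin_num.
  by rewrite [fine _]int0.
have ae0 : ae_eq (lebesgue_rV m) D
    (fun x => (l x / f x ^+ n.+1 * l x)%:E) (cst 0%E).
  apply/ae_eq_integral_abs => //; first exact: (measurable_int _ il).
  rewrite -[RHS]int0; apply: eq_integral => x /set_mem /fD fx.
  rewrite gee0_abs// lee_fin mulrAC divr_ge0 ?exprn_ge0 ?(ltW fx)//.
  by rewrite -expr2 sqr_ge0.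
have l0 : l = Affine 0 0.
  apply: (affine_eq0 l (interior D) p); first exact: nbhs_interior.
  move=> x Dx; apply/eqP/negPn/negP => lx.
  have [N [mN N0 sN]] := ae0.
  have : (0 < lebesgue_rV m N)%E.
    apply: (nbhs_lebesgue_rV_gt0 x (D `&` [set y | l y != 0])) => //.
      apply: filterI => //.
      have /continuous_affine// : nbhs (l x) [set t : R | t != 0].
      by apply: open_nbhs_nbhs; split => //; exact: open_neq.
    move=> y [Dy ly]; apply: sN => /= /(_ Dy) [] /eqP.
    by rewrite !mulf_eq0 invr_eq0 expf_eq0 /= (gt_eqF (fD _ Dy)) (negPf ly).
  by rewrite N0 ltxx.
case: l0 => /eqP; rewrite subr_eq0 => /eqP linE /eqP; rewrite subr_eq0 => /eqP.
by clear -linE; case: zeta linE => a c; case: zeta' => a' c' /= -> ->.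
Qed.

End uniqueness.

(** * Transfer of stability *)

Section stability_twist.
Context {R : realType} {m : nat}.
Local Opaque lebesgue_rV.
Implicit Types (D : set 'rV[R]_m) (f l k : affine R m).

(** Where [f x != 0], this function takes the value [f x * k (twist_pt f x)]. *)
Definition untwist_aff f k : affine R m :=
  Affine (aff_lin k + aff_cst k *: aff_lin f) (aff_cst k * aff_cst f).

Lemma untwist_affK f k : aff_cst f != 0 -> twist_aff f (untwist_aff f k) = k.
Proof.
by move=> f0; case: k => a c; rewrite /twist_aff /untwist_aff /= mulfK// addrK.
Qed.

Lemma measurable_bigmax_affine l (s : seq (affine R m)) :
  measurable_fun setT (fun x => \big[Num.max/l x]_(k <- s) k x).
Proof.
elim: s => [|k s IH].
  by under eq_fun do rewrite big_nil; exact: measurable_affine.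
under eq_fun do rewrite big_cons.
by apply: measurable_maxr => //; exact: measurable_affine.
Qed.

Section transfer.
Variables (D : set 'rV[R]_m) (f : affine R m) (phi psi : 'rV[R]_m -> R).
Hypotheses (f0 : aff_cst f != 0) (fD : forall x, D x -> 0 < f x).
Hypothesis psiE : forall x, D x -> psi (twist_pt f x) = phi x / f x.

Let f00 : f 0 != 0. Proof. by rewrite affine0E. Qed.

Lemma bigmax_twist l (s : seq (affine R m)) x : D x ->
  \big[Num.max/twist_aff f l (twist_pt f x)]_(k <- map (twist_aff f) s)
    k (twist_pt f x) = (\big[Num.max/l x]_(k <- s) k x) / f x.
Proof.
move=> Dx; have fx := fD x Dx; have fn0 : f x != 0 by rewrite gt_eqF.
elim: s => [|k s IH]; first by rewrite /= !big_nil twist_affE.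
by rewrite /= !big_cons IH maxr_pMl ?invr_ge0 ?ltW// twist_affE.
Qed.

Lemma convex_pl_twist : convex_pl D phi <-> convex_pl (twist_set f D) psi.
Proof.
split=> [[l [s phiE]]|[l [s phiE]]].
  exists (twist_aff f l), (map (twist_aff f) s) => _ [x Dx <-].
  by rewrite bigmax_twist// psiE// phiE.
exists (untwist_aff f l), (map (untwist_aff f) s) => x Dx.
have fn0 : f x != 0 by rewrite gt_eqF// fD.
apply: (mulIf (invr_neq0 fn0)); rewrite -psiE// -bigmax_twist// -map_comp.
rewrite untwist_affK// (eq_map (g := id)) ?map_id ?phiE//; first by exists x.
by move=> k /=; rewrite untwist_affK.
Qed.

Lemma affine_on_twist : affine_on D phi <-> affine_on (twist_set f D) psi.
Proof.
split=> [[l phiE]|[l phiE]].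
  exists (twist_aff f l) => _ [x Dx <-].
  by rewrite psiE// phiE// twist_affE// gt_eqF// fD.
exists (untwist_aff f l) => x Dx.
have fn0 : f x != 0 by rewrite gt_eqF// fD.
apply: (mulIf (invr_neq0 fn0)); rewrite -psiE// -twist_affE// untwist_affK//.
by apply: phiE; exists x.
Qed.

End transfer.

Variables (D : set 'rV[R]_m) (d : nat) (L : 'I_d -> affine R m) (f : affine R m).
Hypotheses (f0 : 0 < aff_cst f) (fD : forall x, D x -> 0 < f x).
Hypotheses (cD : compact D) (iD : interior D !=set0) (mD : measurable D).

(** The twist is a bijection between the two sets of solutions, and uniqueness makes the choice in
    [xget] commute with it. *)
Lemma extremal_affine_twist :
  extremal_affine (twist_set f D) (twist_labels f L) affine1 0 =
  twist_aff f (extremal_affine D L f (m + 2)%:R).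
Proof.
have fn0 : aff_cst f != 0 by rewrite gt_eqF.
have f00 : f 0 != 0 by rewrite affine0E.
have DFE zeta l :
    DF_wrt (twist_set f D) (twist_labels f L) (twist_aff f zeta) affine1 0
      (twist_aff f l) = aff_cst f * DF_wrt D L zeta f (m + 2)%:R l.
  apply: (DF_wrt_twist _ _ _ _ _ f0 fD mD _ _ _ (twist_aff f l)) => //.
    exact: measurable_affine.
  by move=> x Dx; rewrite twist_affE// gt_eqF// fD.
pose S : set (affine R m) := [set zeta | forall l : affine R m,
  DF_wrt (twist_set f D) (twist_labels f L) zeta affine1 0 l = 0].
pose S' : set (affine R m) := [set zeta | forall l : affine R m,
  DF_wrt D L zeta f (m + 2)%:R l = 0].
transitivity (xget (Affine 0 0) S); first by [].
transitivity (twist_aff f (xget (Affine 0 0) S')); last by [].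
have SP zeta : S (twist_aff f zeta) <-> S' zeta.
  split=> Sz l.
    by apply: (mulfI fn0); rewrite -DFE Sz mulr0.
  by rewrite -(untwist_affK f l fn0) DFE Sz mulr0.
have S'1 zeta zeta' : S' zeta -> S' zeta' -> zeta' = zeta.
  by move=> Sz Sz'; apply: (extremal_affine_unique D _ L f _ _ (m + 2)).
clearbody S S'; have [[zeta Sz]|Sn] := pselect (exists zeta, S' zeta).
  rewrite (xget_unique _ Sz (S'1 zeta ^~ Sz)); apply: xget_unique; first exact/SP.
  by move=> k; rewrite -(untwist_affK f k fn0) => /SP /(S'1 _ _ Sz) ->.
(* Without a solution both sides fall back on [Affine 0 0], which the twist fixes. *)
rewrite !xgetPN; first by rewrite twist_aff_cst0.
  by move=> zeta Sz; apply: Sn; exists zeta.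
move=> k; rewrite -(untwist_affK f k fn0) => /SP Sk; apply: Sn.
by exists (untwist_aff f k).
Qed.

Lemma donaldson_futaki_twist phi psi :
  convex_pl D phi -> (forall x, D x -> psi (twist_pt f x) = phi x / f x) ->
  donaldson_futaki (twist_set f D) (twist_labels f L) affine1 0 psi =
  aff_cst f * donaldson_futaki D L f (m + 2)%:R phi.
Proof.
move=> phiC psiE; rewrite /donaldson_futaki extremal_affine_twist.
have fn0 : aff_cst f != 0 by rewrite gt_eqF.
(* The maximum of affine functions that represents [psi] on the twisted set serves as its measurable
   stand-in. *)
have /(convex_pl_twist _ _ _ _ fn0 fD psiE)[l [s psi0E]] := phiC.
exact: (DF_wrt_twist _ _ _ _ _ f0 fD mD _ _ _ _ (measurable_bigmax_affine l s)).
Qed.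

Lemma K_stable_twist :
  fw_K_stable D L f (m + 2)%:R <-> K_stable (twist_set f D) (twist_labels f L).
Proof.
have fn0 : aff_cst f != 0 by rewrite gt_eqF.
have f00 : f 0 != 0 by rewrite affine0E.
have transfer phi psi :
    convex_pl D phi -> (forall x, D x -> psi (twist_pt f x) = phi x / f x) ->
    (0 <= donaldson_futaki D L f (m + 2)%:R phi /\
      (donaldson_futaki D L f (m + 2)%:R phi = 0 <-> affine_on D phi)) <->
    (0 <= donaldson_futaki (twist_set f D) (twist_labels f L) affine1 0 psi /\
      (donaldson_futaki (twist_set f D) (twist_labels f L) affine1 0 psi = 0 <->
       affine_on (twist_set f D) psi)).
  move=> phiC psiE; rewrite (donaldson_futaki_twist phi psi phiC psiE).
  rewrite (pmulr_rge0 _ f0) -(affine_on_twist _ _ _ _ fn0 fD psiE).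
  have -> : (aff_cst f * donaldson_futaki D L f (m + 2)%:R phi = 0) =
      (donaldson_futaki D L f (m + 2)%:R phi = 0).
    by apply/propext; split => [/(canRL (mulKf fn0))|->]; rewrite mulr0.
  by [].
split=> stable.
  move=> psi psiC; pose phi x := psi (twist_pt f x) * f x.
  have psiE x : D x -> psi (twist_pt f x) = phi x / f x.
    by move=> Dx; rewrite /phi mulfK// gt_eqF// fD.
  have phiC : convex_pl D phi by exact/(convex_pl_twist _ _ _ _ fn0 fD psiE).
  by apply/(transfer phi psi phiC psiE); exact: stable.
move=> phi phiC.
(* [T'] inverts the twist on the image of [D], so [psi] is [phi / f] transported there. *)
pose T' := twist_pt (twist_aff f affine1).
pose psi y := phi (T' y) / f (T' y).
have psiE x : D x -> psi (twist_pt f x) = phi x / f x.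
  by move=> Dx; rewrite /psi /T' twist_pt_aff1// gt_eqF// fD.
have psiC : convex_pl (twist_set f D) psi.
  exact/(convex_pl_twist _ _ _ _ fn0 fD psiE).
by apply/(transfer phi psi phiC psiE); exact: stable.
Qed.

End stability_twist.

Lemma measurable_halfspaces (R : realType) m d (L : 'I_d -> affine R m) :
  measurable [set x : 'rV[R]_m | forall i, 0 <= L i x].
Proof.
rewrite (_ : [set x | _] = \bigcap_(i in [set: 'I_d]) (L i @^-1` `[0, +oo[%classic)).
  apply: fin_bigcap_measurable => // i _; rewrite -[X in measurable X]setTI.
  exact: measurable_affine.
by apply/seteqP; split=> x /= Lx i => [_|]; have := Lx i; rewrite /= in_itv /= andbT//; exact.
Qed.

Theorem corollary5p12 (R : realType) (m d : nat) (Delta : set 'rV[R]_m)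
    (L : 'I_d -> affine R m) (f : affine R m) :
  labelled_polytope Delta L ->
  Delta 0 ->
  (forall x, Delta x -> 0 < f x) ->
  fw_K_stable Delta L f (m + 2)%:R <->
  K_stable (twist_set f Delta) (twist_labels f L).
Proof.
move=> [cD iD DE _ _ _] D0 fD; apply: K_stable_twist => //.
  by rewrite -affine0E; exact: fD.
by rewrite DE; exact: measurable_halfspaces.
Qed.
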